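(* For each $x\in(0,\infty)$, as $m,n\to\infty$, the mean-squared error of the Szasz estimator is of the form $$\operatorname{MSE}\left[\hat F^S_{m,n}(x)\right]=\operatorname{Var}\left[\hat F^S_{m,n}(x)\right]+\operatorname{Bias}\left[\hat F^S_{m,n}(x)\right]^2$$ $$=n^{-1}\sigma^2(x)-m^{-1/2}n^{-1}V^S(x)+m^{-2}\left(b^S(x)\right)^2+o_x(m^{-2})+o_x(m^{-1/2}n^{-1}),$$ where $\sigma^2(x)=F(x)(1-F(x))$, $V^S(x)=f(x)\left[\frac{x}{\pi}\right]^{1/2}$ and $b^S(x)=\frac{xf'(x)}{2}$.
   Context: Let $X_1,X_2,\dots$ be i.i.d. random variables with values in $[0,\infty)$, with distribution function $F$ ($F(0)=0$) and density $f$. Standing assumption: $F$ is continuous, and the first and second derivatives $f=F'$ and $f'=F''$ of $F$ exist and are continuous and bounded on $[0,\infty)$. The empirical distribution function is $F_n(x)=\frac1n\sum_{i=1}^n \mathbb{I}(X_i\le x)$. For $m\in\mathbb{N}$, $m\geq 1$, $k\in\{0,1,2,\dots\}$ and $x\ge 0$ let $V_{k,m}(x)=e^{-mx}\frac{(mx)^k}{k!}$ (with $0^0=1$). The Szasz estimator is $\hat F^S_{m,n}(x)=\sum_{k=0}^\infty F_n\left(\frac km\right)V_{k,m}(x)$. Its bias is $\operatorname{Bias}[\hat F^S_{m,n}(x)]=\mathbb{E}[\hat F^S_{m,n}(x)]-F(x)$ and its mean-squared error is $\operatorname{MSE}[\hat F^S_{m,n}(x)]=\mathbb{E}\left[\left(\hat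 F^S_{m,n}(x)-F(x)\right)^2\right]$. The notation $u=o_x(v)$ means $\lim|u/v|=0$ as $m,n\to\infty$, where the rate of convergence may depend on $x$. *)

(* Defs.v *)
From HB Require Import structures.
From mathcomp Require Import all_boot all_order all_algebra.
From mathcomp Require Import all_classical all_reals all_analysis.

Set Implicit Arguments.
Unset Strict Implicit.
Unset Printing Implicit Defensive.

Import Order.TTheory GRing.Theory Num.Theory.
Import numFieldNormedType.Exports.

Local Open Scope classical_set_scope.
Local Open Scope ring_scope.

(* The limit is taken along A only, so at an endpoint of an interval A the
   derivative is one-sided. *)
Definition has_derivative_on (R : realType) (A : set R) (g g' : R -> R) :=
  forall x, A x -> (g y - g x) / (y - x) @[y --> within A x^'] --> g' x.

Section random_sequence.
Context d (T : measurableType d) (R : realType) (P : probability T R).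
Local Open Scope ereal_scope.

Definition mutually_independent (X : nat -> {RV P >-> R}) :=
  forall (s : seq nat) (B : nat -> set R),
    uniq s -> (forall i, measurable (B i)) ->
    P (\bigcap_(i in [set` s]) (X i @^-1` B i)) =
    \prod_(i <- s) P (X i @^-1` B i).

Definition identically_distributed (X : nat -> {RV P >-> R}) :=
  forall (i j : nat) (B : set R), measurable B ->
    distribution P (X i) B = distribution P (X j) B.

Definition iid (X : nat -> {RV P >-> R}) :=
  mutually_independent X /\ identically_distributed X.

End random_sequence.

(* Observations are numbered from 0: the sample of size n is
   xs 0, ..., xs (n - 1). *)
Definition empirical_cdf (R : realType) (xs : nat -> R) (n : nat) (x : R) : R :=
  n%:R^-1 * \sum_(i < n) (xs i <= x)%R%:R.

Definition szasz_weight (R : realType) (k m : nat) (x : R) : R :=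
  expR (- (m%:R * x)) * ((m%:R * x) ^+ k / k`!%:R).

Definition szasz_estimator (R : realType) (xs : nat -> R) (m n : nat) (x : R)
    : R :=
  limn (series (fun k : nat =>
    empirical_cdf xs n (k%:R / m%:R) * szasz_weight k m x)).

Section error_measures.
Context d (T : measurableType d) (R : realType) (P : probability T R).
Local Open Scope ereal_scope.

Definition bias (Y : T -> R) (theta : R) : \bar R := 'E_P[Y] - theta%:E.

Definition mse (Y : T -> R) (theta : R) : \bar R :=
  'E_P[(fun w => (Y w - theta) ^+ 2)%R].

End error_measures.

(* Main.v *)
Require Import Defs.
From HB Require Import structures.
From mathcomp Require Import all_boot all_order all_algebra.
From mathcomp Require Import all_classical all_reals all_analysis.
From mathcomp Require Import measurable_realfun ring lra zify.

Import Order.TTheory GRing.Theory Num.Theory.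
Import numFieldNormedType.Exports.

Local Open Scope classical_set_scope.
Local Open Scope ring_scope.

(* Write K, L for independent Poisson(mx) variables. For a fixed sample, the
   estimator is the mean of F_n(K/m), so Fubini and independence give
     E[Fhat] = S := E F(K/m)   and
     E[Fhat^2] = A / n + (1 - 1/n) S^2   with   A := E F(min(K, L)/m),
   hence MSE = (A - S^2) / n + (S - F x)^2.
   A second order Taylor expansion, whose remainder is controlled by the second
   and fourth central moments of K, gives S - F x = x f'(x) / (2m) + o(1/m).
   A first order one gives A - F x = f(x) E(min(K, L)/m - x) + O(1/m), where
   E(min(K, L) - mx) = - E|K - L| / 2. Conditionally on K + L = N, the
   difference K - L is a simple random walk at time N, whose mean absolute
   value is sqrt(2 N / pi) + O(1) by Wallis' product; therefore
   E|K - L| = 2 sqrt(mx / pi) + O(1). *)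

(** The kink of the minimum produces the m^(-1/2) term: min(u, v) - x is half of (u - x) + (v - x) -
    |u - v|, the centred terms have mean zero, and |K - L| / m has mean of order m^(-1/2). The other
    corrections to A - S^2 are O(1/m), so errors bounded uniformly in the Poisson parameter are good
    enough there, both for the walk and for the passage from sqrt(N) to sqrt(E N). The bias is more
    delicate, since S - F x is needed up to o(1/m). Its Taylor remainder must be controlled on the
    whole half-line because K/m is unbounded; away from x it is dominated by a multiple of the
    fourth power, whose mean is O(1/m^2). Finally A and S depend on m alone, so m and n can tend to
    infinity independently. *)

(** * Wallis integrals *)

(* The antiderivative of sin ^+ n vanishing at 0, given by the usual reduction
   formula, which spares us integration. *)
Fixpoint sin_power_primitive {R : realType} (n : nat) (t : R) : R :=
  match n with
  | 0 => t
  | 1 => 1 - cos t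
  | n'.+2 => (n'.+1%:R * sin_power_primitive n' t
              - cos t * sin t ^+ n'.+1) / n'.+2%:R
  end.

Lemma is_derive_sin_power_primitive (R : realType) (n : nat) (t : R) :
  is_derive t 1 (sin_power_primitive n) (sin t ^+ n).
Proof.
have [] : is_derive t 1 (sin_power_primitive n) (sin t ^+ n) /\
          is_derive t 1 (sin_power_primitive n.+1) (sin t ^+ n.+1); last by [].
elim: n => [|n [IH0 IH1]].
  split.
    by rewrite expr0; exact: is_derive_id.
  rewrite [X in is_derive _ _ X _](_ : _ = cst 1 - cos); last by apply/funext.
  apply: is_derive_eq.
  by rewrite sub0r opprK expr1.
split=> //.
rewrite [X in is_derive _ _ X _](_ : _ =
  n.+2%:R^-1 *: (n.+1%:R *: sin_power_primitive n - cos * sin ^+ n.+1)); last first.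
  apply/funext => u; rewrite !fctE /= . by rewrite [LHS]mulrC.
apply: is_derive_eq.
have n2 : (n.+2%:R : R) != 0 by rewrite pnatr_eq0.
apply: (mulfI n2); rewrite -![_ *: _]/(_ * _) mulVKf//.
have s2 : sin t ^+ n.+2 = (1 - cos t ^+ 2) * sin t ^+ n.
  by rewrite -(cos2Dsin2 t) addrC addKr -exprD.
have s1 : sin t ^+ n.+1 * - sin t = - sin t ^+ n.+2 by rewrite mulrN -exprSr.
rewrite !fctE /=.
by rewrite s1 -[n.+2%:R]natr1 mulrDl s2; ring.
Qed.

Lemma sin_power_primitive0 (R : realType) (n : nat) :
  sin_power_primitive n (0 : R) = 0.
Proof.
have [] : sin_power_primitive n (0 : R) = 0 /\ sin_power_primitive n.+1 (0 : R) = 0; last by [].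
elim: n => [|n [IH0 IH1]]; first by rewrite /= cos0 subrr.
by split=> //=; rewrite IH0 sin0 expr0n/= mulr0 mulr0 subr0 mul0r.
Qed.

(** The classical integral of [sin ^+ n] over [0, pi / 2], since the primitive vanishes at 0. *)
Definition wallis {R : realType} (n : nat) : R := sin_power_primitive n (pi / 2).

Lemma wallis0 (R : realType) : wallis 0 = pi / 2 :> R.
Proof. by []. Qed.

Lemma wallis1 (R : realType) : wallis 1 = 1 :> R.
Proof. by rewrite /wallis/= cos_pihalf subr0. Qed.

Lemma wallisSS (R : realType) (n : nat) :
  wallis n.+2 = n.+1%:R * wallis n / n.+2%:R :> R.
Proof. by rewrite /wallis/= cos_pihalf mul0r subr0. Qed.

Lemma wallis_gt0 (R : realType) (n : nat) : 0 < wallis n :> R.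
Proof.
have [] : (0 < wallis n :> R) /\ (0 < wallis n.+1 :> R); last by [].
elim: n => [|n [IH0 IH1]].
  by rewrite wallis0 wallis1 divr_gt0 ?pi_gt0.
by split=> //; rewrite wallisSS divr_gt0 ?mulr_gt0.
Qed.

(** On [0, pi / 2] the sine lies in [0, 1], so its powers decrease with the exponent. The mean value
    theorem, applied to the difference of the two primitives, replaces monotonicity of the
    integral. *)
Lemma wallisS_le (R : realType) (n : nat) : wallis n.+1 <= wallis n :> R.
Proof.
have pi2 : 0 < pi / 2 :> R by rewrite divr_gt0 ?pi_gt0.
pose h (t : R) := sin_power_primitive n t - sin_power_primitive n.+1 t.
have dh (t : R) : is_derive t 1 h (sin t ^+ n - sin t ^+ n.+1).
  have := is_derive_sin_power_primitive R n t.
  have := is_derive_sin_power_primitive R n.+1 t.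
  by move=> ? ?; apply: is_deriveB.
suff : h 0 <= h (pi / 2).
  by rewrite /h !sin_power_primitive0 subrr subr_ge0.
have [|t /[!in_itv]/= /andP[t0 t1] ht] := @MVT R h _ _ _ pi2 (fun t _ => dh t).
  by apply: derivable_within_continuous => t _; case: (dh t).
rewrite -subr_ge0 ht mulr_ge0 ?subr_ge0 ?(ltW pi2)//.
have s0 : 0 <= sin t.
  apply: sin_ge0_pi; rewrite (ltW t0)/= (le_trans (ltW t1))//.
  by rewrite ler_pdivrMr// ler_peMr ?pi_ge0 ?ler1n.
by rewrite exprS ler_piMl ?exprn_ge0 ?sin_le1.
Qed.

(** By the reduction formula, (n + 1) W_n W_(n+1) does not depend on n. *)
Lemma wallis_mul (R : realType) (n : nat) :
  wallis n * wallis n.+1 = pi / (2 * n.+1%:R) :> R.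
Proof.
elim: n => [|n IH]; first by rewrite wallis0 wallis1 !mulr1.
rewrite wallisSS mulrA mulrCA (mulrC (wallis n.+1)) IH.
have n0 := ler0n R n.
by field; apply/andP; split; apply: lt0r_neq0; lra.
Qed.

(** A non-asymptotic form of Wallis' product: by monotonicity, the square lies between two
    consecutive products. *)
Lemma wallis_sqr_bounds (R : realType) (n : nat) :
  (pi / (2 * n.+2%:R) : R) <= (wallis n.+1 : R) ^+ 2 <= pi / (2 * n.+1%:R).
Proof.
rewrite -!wallis_mul expr2; have w0 := ltW (wallis_gt0 R n.+1).
by apply/andP; split; [rewrite ler_wpM2l|rewrite ler_wpM2r]; rewrite ?wallisS_le.
Qed.

(** * The mean absolute value of the simple random walk *)

(** Pascal's rule, in the form that conditions a walk of N + 1 steps on one of its steps. *)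
Lemma sum_bin_Pascal (R : pzRingType) (N : nat) (g : nat -> R) :
  \sum_(k < N.+2) 'C(N.+1, k)%:R * g k =
  \sum_(k < N.+1) 'C(N, k)%:R * (g k + g k.+1).
Proof.
rewrite big_ord_recl bin0 mul1r.
under eq_bigr => k _ do rewrite lift0 binS natrD mulrDl.
rewrite big_split/= big_ord_recr/= bin_small// mul0r addr0.
under [RHS]eq_bigr do rewrite mulrDr.
rewrite big_split/= addrA; congr (_ + _).
by rewrite [RHS]big_ord_recl bin0 mul1r.
Qed.

(* E|S_N| for the simple random walk S: at time N, the position is N - 2 k with
   probability 'C(N, k) / 2 ^ N. *)
Definition mean_abs_walk {R : realType} (N : nat) : R :=
  2 ^- N * \sum_(k < N.+1) 'C(N, k)%:R * `|N%:R - 2 * k%:R|.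

Lemma mean_abs_walk_ge0 (R : realType) (N : nat) : 0 <= mean_abs_walk N :> R.
Proof.
by rewrite mulr_ge0 ?invr_ge0 ?exprn_ge0 ?sumr_ge0// => k _; rewrite mulr_ge0.
Qed.

(** At position d the next mean absolute value (|d + 1| + |d - 1|) / 2 equals |d|, except at d = 0,
    where it exceeds it by 1. The increment is therefore the probability of being at 0 at time N. *)
Lemma mean_abs_walkS (R : realType) (N : nat) :
  mean_abs_walk N.+1 =
  mean_abs_walk N + (if odd N then 0 else 'C(N, N./2)%:R / 2 ^+ N) :> R.
Proof.
rewrite /mean_abs_walk.
rewrite (sum_bin_Pascal R N (fun k => `|N.+1%:R - 2 * k%:R|)).
have absE (k : nat) : `|N.+1%:R - 2 * k%:R| + `|N.+1%:R - 2 * k.+1%:R| =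
    2 * (`|N%:R - 2 * k%:R| + (N == k.*2)%:R) :> R.
  rewrite -![_.+1%:R]natr1; case: ltgtP => [Nk|kN|->]; rewrite ?mulr0n ?mulr1n.
  - have : N.+1%:R <= (k.*2)%:R :> R by rewrite ler_nat.
    by rewrite -natr1 -muln2 natrM => H; rewrite !ler0_norm; lra.
  - have : (k.*2).+1%:R <= N%:R :> R by rewrite ler_nat.
    by rewrite -natr1 -muln2 natrM => H; rewrite !ger0_norm; lra.
  - rewrite -muln2 natrM.
    rewrite [`|_ + 1 - _|]ger0_norm; last lra.
    rewrite [`|_ + 1 - _|]ler0_norm; last lra.
    rewrite [`|_ - _|]ger0_norm; lra.
under eq_bigr => k _ do rewrite absE mulrCA mulrDr.
rewrite -mulr_sumr big_split/= exprS invfM mulrACA mulVf ?pnatr_eq0// mul1r.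
rewrite mulrDr; congr (_ + _); case: ifPn => [oN|eN].
  rewrite big1 ?mulr0// => k _; case: eqP => [Nk|]; last by rewrite mulr0.
  by have := oN; rewrite [in odd _]Nk odd_double.
have Nh : N = (N./2).*2 by rewrite -{1}(odd_double_half N) (negbTE eN).
have hN : (N./2 < N.+1)%N by lia.
rewrite (bigD1 (Ordinal hN))//= -Nh eqxx mulr1 big1 ?addr0 1?mulrC// => k kh.
rewrite (_ : N == k.*2 = false) ?mulr0//; apply: contraNF kh => /eqP Nk.
by apply/eqP/val_inj => /=; rewrite -[LHS]doubleK -Nk.
Qed.

(** Both sides obey the same recurrence in j. The index starts at j + 1 because the pattern would
    ask for W_(-1) at the coefficient 'C(0, 0). *)
Lemma central_bin (R : realType) (j : nat) :
  'C(j.+1.*2, j.+1)%:R / 2 ^+ j.+1.*2 = (j.+1.*2%:R * wallis j.*2.+1)^-1 :> R.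
Proof.
elim: j => [|j IH].
  by rewrite wallis1 mulr1 bin1 -[1.*2]/2%N expr2; field.
have step : (j.+2%:R * 'C(j.+2.*2, j.+2)%:R =
    2 * j.*2.+3%:R * 'C(j.+1.*2, j.+1)%:R :> R).
  rewrite -!natrM; congr _%:R; have := mul_bin_diag j.+2.*2 j.+1.
  rewrite doubleS /= => <-.
  have := mul_bin_down j.+1.*2.+1 j.+1; rewrite /= => e.
  suff : (j.+2 * 'C(j.+1.*2.+1, j.+1) = j.*2.+3 * 'C(j.+1.*2, j.+1))%N.
    move=> e2; rewrite -mulnA -e2. lia.
  move: e. rewrite (_ : j.+1.*2.+1 - j.+1 = j.+2)%N; last lia.
  by move=> <-; congr (_ * _)%N; lia.
have j2 : (j.+2%:R : R) != 0 by rewrite pnatr_eq0.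
apply: (mulfI j2); rewrite mulrA step -[j.+2.*2]/(j.+1.*2.+2) [in wallis _]doubleS wallisSS.
have wn := lt0r_neq0 (wallis_gt0 R j.*2.+1).
(* The factor 2 (2j + 3) comes from [step]; the division by 4 turns 2^(2j+2) into 2^(2j+4). *)
move: IH => /(congr1 (fun z => z * (2 * j.*2.+3%:R / 4))).
rewrite (_ : _ * (_ / 4) = 2 * j.*2.+3%:R * 'C(j.+1.*2, j.+1)%:R / 2 ^+ j.+1.*2.+2); last first.
  rewrite !exprSr; field.
  by rewrite expf_neq0.
move=> ->.
rewrite -!muln2 in wn *; have j0 := ler0n R j.
by field; rewrite wn/=; apply/and4P; split; apply: lt0r_neq0; lra.
Qed.

(** The mean does not move after an odd time, and after the even time 2j + 2 it grows by 1 / ((2j +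
    2) W_(2j+1)); the reduction formula turns this sum into 1 / W_(2j+3). *)
Lemma mean_abs_walk_wallis (R : realType) (j : nat) :
  (mean_abs_walk j.*2.+1 = (wallis j.*2.+1)^-1 :> R) /\
  (mean_abs_walk j.+1.*2 = (wallis j.*2.+1)^-1 :> R).
Proof.
suff H : mean_abs_walk j.*2.+1 = (wallis j.*2.+1)^-1 :> R.
  by split=> //; rewrite doubleS mean_abs_walkS/= odd_double/= addr0.
elim: j => [|j IH].
  rewrite mean_abs_walkS /= /mean_abs_walk big_ord1 bin0 wallis1 expr0.
  by rewrite mulr0 subr0 normr0 !mulr0 divr1 add0r invr1.
rewrite mean_abs_walkS oddS/= odd_double /= doubleS mean_abs_walkS /= odd_double /= addr0 IH.
rewrite -doubleS doubleK central_bin [in RHS]doubleS wallisSS.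
have wn := lt0r_neq0 (wallis_gt0 R j.*2.+1).
have j0 := ler0n R j; rewrite -!muln2 in wn *.
by field; rewrite wn/=; apply/and3P; split; apply: lt0r_neq0; lra.
Qed.

Lemma mean_abs_walk_sqr_bounds (R : realType) (N : nat) :
  (2 / pi * (N%:R - 1) : R) <= (mean_abs_walk N : R) ^+ 2 <= 2 / pi * (N%:R + 1).
Proof.
have pi0 := pi_gt0 R.
have [->|N0] := eqVneq N 0%N.
  rewrite /mean_abs_walk big_ord1 mulr0 subr0 normr0 !mulr0 expr0n/=.
  have : 0 < 2 / pi :> R by rewrite divr_gt0.
  by move=> ?; apply/andP; split; lra.
have [j Nj] : exists j, (N = j.*2.+1) \/ (N = j.+1.*2).
  exists (N.-1)./2; have := odd_double_half N.-1; case: (odd N.-1) => /= h; [right|left]; lia.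
have wE : mean_abs_walk N = (wallis j.*2.+1)^-1 :> R.
  by have [h1 h2] := mean_abs_walk_wallis R j; case: Nj => ->.
(* The bounds on W_(2j+1) give 2j + 1 and 2j + 2; in both parities N - 1 <= 2j + 1 and 2j + 2 <= N +
   1. *)
have [Nl Nu] : (j.*2.+1 <= N)%N /\ (N <= j.*2.+2)%N by case: Nj => ->; split; lia.
have /andP[wl wu] := wallis_sqr_bounds R j.*2.
have w0 := wallis_gt0 R j.*2.+1.
have w20 : 0 < wallis j.*2.+1 ^+ 2 :> R by rewrite exprn_gt0.
have Nle : N%:R <= j.*2.+2%:R :> R by rewrite ler_nat.
have leN : j.*2.+1%:R <= N%:R :> R by rewrite ler_nat.
have c0 : 0 <= 2 / pi :> R by rewrite divr_ge0 ?ltW.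
have invE (k : nat) : 2 / pi * k.+1%:R = (pi / (2 * k.+1%:R))^-1 :> R.
  by rewrite invf_div mulrAC.
have posE (k : nat) : 0 < pi / (2 * k.+1%:R) :> R by rewrite divr_gt0 ?mulr_gt0.
rewrite wE exprVn; apply/andP; split.
  apply: (@le_trans _ _ (2 / pi * j.*2.+1%:R)).
    by rewrite ler_wpM2l// lerBlDr natr1.
  by rewrite invE lef_pV2 ?posrE.
apply: (@le_trans _ _ (2 / pi * j.*2.+2%:R)).
  by rewrite invE lef_pV2 ?posrE.
by rewrite ler_wpM2l// -natr1 lerD2r.
Qed.

Lemma mean_abs_walk_approx (R : realType) (N : nat) :
  `|mean_abs_walk N - Num.sqrt (2 / pi) * Num.sqrt N%:R| <= 1 :> R.
Proof.
have pi2 := pi_ge2 R; have := mean_abs_walk_sqr_bounds R N.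
have c01 : 0 <= 2 / (pi : R) <= 1.
  by apply/andP; split; [rewrite divr_ge0 ?pi_ge0|rewrite ler_pdivrMr ?mul1r ?pi_gt0].
set c := 2 / (pi : R) in c01 *.
set a := mean_abs_walk N.
have a0 : 0 <= a.
  exact: mean_abs_walk_ge0.
have ss : (Num.sqrt c * Num.sqrt N%:R) ^+ 2 = c * N%:R.
  by rewrite exprMn !sqr_sqrtr//; case/andP : c01.
have s0 : 0 <= Num.sqrt c * Num.sqrt N%:R by rewrite mulr_ge0.
set s := Num.sqrt c * Num.sqrt N%:R in ss s0 *.
move=> /andP[l u]; case/andP : c01 => c0 c1.
(* With a and s nonnegative, |a - s| > 1 would give |a^2 - s^2| >= |a - s|^2 > 1, whereas this
   difference is at most c <= 1. *)
rewrite ler_norml; apply/andP; split.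
nra. nra.
Qed.

(** * Poisson moments *)

(* The second argument of poisson_prob is a dummy. *)
Definition poisson {R : realType} (lam : R) : probability nat R :=
  poisson_prob lam 0%N.

Lemma measurable_fun_nat d (U : measurableType d) (f : nat -> U) :
  measurable_fun setT f.
Proof. by []. Qed.

Lemma integral_poisson (R : realType) (lam : R) (f : nat -> \bar R) :
  0 < lam -> (forall k, 0 <= f k)%E ->
  (\int[poisson lam]_k f k = \sum_(k <oo) (poisson_pmf lam k)%:E * f k)%E.
Proof.
move=> lam0 f0.
(* The Poisson law as a series of weighted Dirac masses, against which integration is summation. *)
pose m_ (k : nat) : {measure set nat -> \bar R} :=
  mscale (NngNum (poisson_pmf_ge0 lam k)) (dirac k).
rewrite (eq_measure_integral (mseries m_ 0)); last first.
  move=> A _ _; rewrite /poisson /= /poisson_prob lam0 esum_mkcond.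
  rewrite -nneseries_esumT; last first.
    by move=> k; case: ifP => // _; rewrite lee_fin poisson_pmf_ge0.
  apply: eq_eseriesr => k _; rewrite /m_ /= /mscale /= /dirac indicE.
  by case: ifP => _; rewrite ?mule1 ?mule0.
rewrite ge0_integral_measure_series//; apply: eq_eseriesr => k _.
by rewrite ge0_integral_mscale//= integral_dirac// diracT mul1e.
Qed.

(** The weights satisfy k p(k) = lam p(k - 1). At k = 0 the truncated predecessor is harmless, as
    the factor k vanishes. *)
Lemma poisson_size_bias (R : realType) (lam : R) (g : nat -> R) :
  0 < lam -> (forall k, 0 <= g k) ->
  (\int[poisson lam]_k (k%:R * g k.-1)%:E = lam%:E * \int[poisson lam]_k (g k)%:E)%E.
Proof.
move=> lam0 g0.
have p0 := poisson_pmf_ge0 lam.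
rewrite !integral_poisson//; last by move=> k; rewrite lee_fin mulr_ge0.
have e0 k : (0 <= (poisson_pmf lam k)%:E * (k%:R * g k.-1)%:E)%E.
  by rewrite -EFinM lee_fin !mulr_ge0.
rewrite nneseries_recl// mul0r mule0 add0e -nneseries_addn// -nneseriesZl//; last first.
  by move=> k _; rewrite -EFinM lee_fin mulr_ge0.
apply: eq_eseriesr => k _; rewrite -!EFinM addn1; congr EFin.
rewrite /poisson_pmf lam0 exprS factS natrM/=.
have k1 : (k.+1%:R : R) != 0 by rewrite pnatr_eq0.
have kf : (k`!%:R : R) != 0 by rewrite pnatr_eq0 -lt0n fact_gt0.
by field; rewrite kf nat1r k1.
Qed.

Lemma integral_poisson_ffact (R : realType) (lam : R) (j : nat) : 0 < lam ->
  (\int[poisson lam]_k ((k ^_ j)%:R)%:E = (lam ^+ j)%:E)%E.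
Proof.
move=> lam0; elim: j => [|j IH].
  under eq_integral do rewrite ffactn0.
  by rewrite (integral_cst _ _ 1%E)// mul1e; exact: probability_setT.
under eq_integral => k _ do rewrite ffactnS natrM.
by rewrite (poisson_size_bias R lam (fun k => (k ^_ j)%:R))// IH -EFinM -exprS.
Qed.

(** Falling factorials have the simplest Poisson moments and span the polynomials, so any polynomial
    moment can be read off its coefficients in this basis. *)
Lemma Rintegral_poisson_ffact_sum (R : realType) (lam : R) (n : nat)
    (c : nat -> R) : 0 < lam ->
  (poisson lam).-integrable setT
    (EFin \o (fun k => \sum_(j < n) c j * (k ^_ j)%:R)) /\
  \int[poisson lam]_k (\sum_(j < n) c j * (k ^_ j)%:R) =
    \sum_(j < n) c j * lam ^+ j.
Proof.
move=> lam0.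
have iff j : (poisson lam).-integrable setT (EFin \o (fun k => (k ^_ j)%:R)).
  apply/integrableP; split; first by [].
  under eq_integral => k _ do rewrite /= ger0_norm//.
  by rewrite integral_poisson_ffact// ltry.
have icff j : (poisson lam).-integrable setT
    (EFin \o (fun k => c j * (k ^_ j)%:R)).
  by apply: eq_integrable (integrableZl _ (c j) (iff j)).
elim: n => [|n [IH1 IH2]].
  rewrite big_ord0.
  under eq_fun do rewrite big_ord0.
  by split; [exact: integrable0|rewrite Rintegral_cst// mul0r].
split.
  pose f k := \sum_(j < n) c j * (k ^_ j)%:R.
  pose g k := c n * (k ^_ n)%:R.
  rewrite (_ : EFin \o _ = ((EFin \o f) \+ (EFin \o g))%E); first exact: (integrableD measurableT IH1 (icff n)).
  by apply/funext => k /=; rewrite big_ord_recr.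
under eq_Rintegral => k _ do rewrite big_ord_recr/=.
rewrite RintegralD// IH2 RintegralZl// big_ord_recr/=.
by congr (_ + _ * _); rewrite /Rintegral integral_poisson_ffact.
Qed.

(** The subtraction takes place in [R]; where it is negative, the factor [k ^_ j] is 0. *)
Lemma natr_ffactS (R : pzRingType) (k j : nat) :
  (k ^_ j.+1)%:R = (k ^_ j)%:R * (k%:R - j%:R) :> R.
Proof.
rewrite ffactnSr natrM; have [jk|kj] := leqP j k; first by rewrite natrB.
by rewrite ffact_small// !mul0r.
Qed.

Lemma poisson_mean (R : realType) (lam : R) : 0 < lam ->
  (poisson lam).-integrable setT (EFin \o (fun k => k%:R)) /\
  \int[poisson lam]_k k%:R = lam.
Proof.
move=> lam0.
have := Rintegral_poisson_ffact_sum R lam 2 (fun j => [:: 0; 1]`_j) lam0.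
have kE (k : nat) : \sum_(j < 2) [:: 0; 1]`_j * (k ^_ j)%:R = k%:R :> R.
  by rewrite !big_ord_recr big_ord0/= mul0r !add0r mul1r ffactn1.
under eq_fun do rewrite kE.
by rewrite !big_ord_recr big_ord0/= mul0r !add0r mul1r expr1.
Qed.

Lemma poisson_variance (R : realType) (lam : R) : 0 < lam ->
  (poisson lam).-integrable setT (EFin \o (fun k => (k%:R - lam) ^+ 2)) /\
  \int[poisson lam]_k (k%:R - lam) ^+ 2 = lam.
Proof.
move=> lam0.
(* Coefficients of (k - lam)^2 in the basis of falling factorials. *)
pose c := [:: lam ^+ 2; 1 - 2 * lam; 1].
have := Rintegral_poisson_ffact_sum R lam 3 (fun j => c`_j) lam0.
have kE (k : nat) : \sum_(j < 3) c`_j * (k ^_ j)%:R = (k%:R - lam) ^+ 2 :> R.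
  by rewrite !big_ord_recr big_ord0/= !natr_ffactS ffactn0; ring.
under eq_fun do rewrite kE.
rewrite !big_ord_recr big_ord0/=.
by move=> [? ->]; split=> //; ring.
Qed.

Lemma poisson_central_moment4 (R : realType) (lam : R) : 0 < lam ->
  (poisson lam).-integrable setT (EFin \o (fun k => (k%:R - lam) ^+ 4)) /\
  \int[poisson lam]_k (k%:R - lam) ^+ 4 = lam + 3 * lam ^+ 2.
Proof.
move=> lam0.
(* Coefficients of (k - lam)^4 in the same basis; the constants 1, 7, 6, 1 are the Stirling numbers
   of k^4. *)
pose c := [:: lam ^+ 4; 1 - 4 * lam + 6 * lam ^+ 2 - 4 * lam ^+ 3;
              7 - 12 * lam + 6 * lam ^+ 2; 6 - 4 * lam; 1].
have := Rintegral_poisson_ffact_sum R lam 5 (fun j => c`_j) lam0.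
have kE (k : nat) : \sum_(j < 5) c`_j * (k ^_ j)%:R = (k%:R - lam) ^+ 4 :> R.
  by rewrite !big_ord_recr big_ord0/= !natr_ffactS ffactn0; ring.
under eq_fun do rewrite kE.
rewrite !big_ord_recr big_ord0/=.
by move=> [? ->]; split=> //; ring.
Qed.

(** * The mean distance of two independent Poisson variables *)

Lemma integrable_dist_le d (T : measurableType d) (R : realType)
    (mu : {measure set T -> \bar R}) (f h g : T -> R) :
  measurable_fun setT f -> mu.-integrable setT (EFin \o h) ->
  mu.-integrable setT (EFin \o g) -> (forall t, `|f t - h t| <= g t) ->
  mu.-integrable setT (EFin \o f).
Proof.
move=> mf ih ig fhg.
have mh : measurable_fun setT h by apply/measurable_EFinP; case/integrableP : ih.
have ifh : mu.-integrable setT (EFin \o (f \- h)).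
  apply: (le_integrable measurableT _ _ ig).
    by apply/measurable_EFinP; exact: measurable_funB.
  by move=> t _; rewrite /= lee_fin (le_trans (fhg t))// ler_norm.
apply: (eq_integrable measurableT _ _ _ (integrableD measurableT ifh ih)).
by move=> t _ /=; rewrite -EFinD subrK.
Qed.

(** The form in which pointwise expansions are integrated below: [h] is the main term and [g] the
    error, and the integrability of [f] follows from theirs. *)
Lemma Rintegral_dist_le d (T : measurableType d) (R : realType)
    (mu : {measure set T -> \bar R}) (f h g : T -> R) :
  measurable_fun setT f -> mu.-integrable setT (EFin \o h) ->
  mu.-integrable setT (EFin \o g) -> (forall t, `|f t - h t| <= g t) ->
  `|\int[mu]_t f t - \int[mu]_t h t| <= \int[mu]_t g t.
Proof.
move=> mf ih ig fhg; have if_ := integrable_dist_le _ _ _ _ _ _ _ mf ih ig fhg.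
have ifh : mu.-integrable setT (EFin \o (f \- h)).
  by apply: (eq_integrable measurableT _ _ _ (integrableB measurableT if_ ih)).
rewrite -RintegralB//; apply: (le_trans (le_normr_Rintegral _ _)) => //.
apply: le_Rintegral => //.
by apply: (eq_integrable measurableT _ _ _ (integrable_abse ifh)).
Qed.

(** A set of pairs is a countable union of vertical slices. Hence any function of two Poisson
    variables is measurable. *)
Lemma measurable_natX (A : set (nat * nat)) : measurable A.
Proof.
have -> : A = \bigcup_k ([set k] `*` [set l | A (k, l)]).
  apply/seteqP; split=> [[k l] Akl|[k l] [n _] [/= ->]]//.
  by exists k.
by apply: bigcupT_measurable => k; exact: measurableX.
Qed.

Lemma measurable_fun_natX d (U : measurableType d) (f : nat * nat -> U) :
  measurable_fun setT f.
Proof. by move=> _ Y mY; exact: measurable_natX. Qed.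

Lemma poisson_pmf_convolution (R : realType) (lam : R) (N k : nat) :
  0 < lam -> (k <= N)%N ->
  poisson_pmf lam k * poisson_pmf lam (N - k) =
  poisson_pmf (2 * lam) N * (2 ^- N * 'C(N, k)%:R).
Proof.
move=> lam0 kN; rewrite /poisson_pmf lam0 mulr_gt0//.
rewrite -(bin_fact kN) !natrM.
have [k0 Nk0 c0] : [/\ (k`!%:R : R) != 0, ((N - k)`!%:R : R) != 0 &
    ('C(N, k)%:R : R) != 0].
  by split; rewrite pnatr_eq0 -lt0n ?fact_gt0 ?bin_gt0.
have -> : expR (- (2 * lam)) = expR (- lam) * expR (- lam).
  by rewrite -expRD; congr expR; ring.
have -> : (2 * lam) ^+ N = 2 ^+ N * (lam ^+ k * lam ^+ (N - k)).
  by rewrite -exprD subnKC// exprMn.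
have n0 : (2 : R) ^+ N != 0 by rewrite expf_neq0.
set u := 2 ^+ N in n0 *; set v := lam ^+ k; set w := lam ^+ (N - k).
by field; rewrite n0 k0 Nk0 c0.
Qed.

(* Conditionally on the sum of two independent Poisson variables being N, the
   first one is binomial with parameters N and 1/2. *)
Lemma integral_poisson2_sum (R : realType) (lam : R) (f : nat -> nat -> R) :
  0 < lam -> (forall k l, 0 <= f k l) ->
  (\int[poisson lam \x poisson lam]_z (f z.1 z.2)%:E =
   \int[poisson (2 * lam)]_N
     (2 ^- N * \sum_(k < N.+1) 'C(N, k)%:R * f k (N - k)%N)%:E)%E.
Proof.
move=> lam0 f0.
have p0 := @poisson_pmf_ge0 R.
rewrite fubini_tonelli1/=; last 2 first.
- exact: measurable_fun_natX.
- by move=> z; rewrite lee_fin.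
pose a k l : \bar R := (poisson_pmf lam k * poisson_pmf lam l * f k l)%:E.
have a0 k l : (0 <= a k l)%E by rewrite lee_fin !mulr_ge0.
rewrite /fubini_F integral_poisson//; last first.
  by move=> k; apply: integral_ge0 => l _; rewrite lee_fin.
rewrite integral_poisson ?mulr_gt0//; last first.
  move=> N; rewrite lee_fin mulr_ge0 ?invr_ge0 ?exprn_ge0// sumr_ge0// => k _.
  by rewrite mulr_ge0.
(* The second variable is replaced by the sum N. The test [k <= N] lets both series run over all of
   nat, so that they can be interchanged. *)
transitivity (\sum_(k <oo) \sum_(N <oo) (if (k <= N)%N then a k (N - k)%N else 0))%E.
  apply: eq_eseriesr => k _.
  rewrite -eseries_mkcond.
  rewrite (_ : (\sum_(N <oo | (k <= N)%N) _ = \sum_(k <= N <oo) a k (N - k)%N)%E);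
    last by rewrite [RHS]eseries_cond.
  rewrite -(@nneseries_addn _ (fun N => a k (N - k)%N)); last by move=> ?.
  rewrite integral_poisson//=; last by move=> l; rewrite lee_fin.
  rewrite -nneseriesZl; last first.
    by move=> l _; rewrite -EFinM lee_fin mulr_ge0.
  by apply: eq_eseriesr => l _; rewrite addnK /a -!EFinM mulrA.
rewrite nneseries_interchange; last by move=> k N; case: ifP.
apply: eq_eseriesr => N _.
rewrite (nneseries_split 0 N.+1); last by move=> k _; case: ifP.
rewrite [X in (_ + X)%E]eseries0 ?adde0; last first.
  by move=> k; rewrite add0n => Nk _; rewrite leqNgt Nk.
rewrite add0n big_mkord -EFinM mulrA mulr_sumr -sumEFin.
apply: eq_bigr => k _; rewrite -ltnS ltn_ord /a poisson_pmf_convolution//.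
  by congr EFin; rewrite !mulrA.
by rewrite -ltnS.
Qed.

Lemma integral_poisson2_dist (R : realType) (lam : R) : 0 < lam ->
  (\int[poisson lam \x poisson lam]_z (`|z.1%:R - z.2%:R|)%:E =
   \int[poisson (2 * lam)]_N (mean_abs_walk N)%:E)%E.
Proof.
move=> lam0.
rewrite (integral_poisson2_sum R lam (fun k l => `|k%:R - l%:R|))//.
apply: eq_integral => N _; congr (_ * _)%:E; apply: eq_bigr => k _.
rewrite distrC natrB; last by rewrite -ltnS.
by congr (_ * `|_|); ring.
Qed.

(** With u, v the two roots, (a - b)^2 / b = ((u - v) (1 + u / v))^2 >= (u - v)^2, and 2 |u - v| <=
    (u - v)^2 + 1. The bound is quadratic in a so that, for a Poisson variable a of mean b, its
    expectation is a variance over b and equals 1. *)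
Lemma sqrtr_dist_le (R : realType) (a b : R) : 0 <= a -> 0 < b ->
  `|Num.sqrt a - Num.sqrt b| <= ((a - b) ^+ 2 / b + 1) / 2.
Proof.
move=> a0 b0; have sb : 0 < Num.sqrt b by rewrite sqrtr_gt0.
have sa : 0 <= Num.sqrt a by exact: sqrtr_ge0.
rewrite -{2}(sqr_sqrtr a0) -{2 3}(sqr_sqrtr (ltW b0)).
set u := Num.sqrt a in sa *; set v := Num.sqrt b in sb *.
have -> : (u ^+ 2 - v ^+ 2) ^+ 2 / v ^+ 2 = ((u - v) * (1 + u / v)) ^+ 2.
  by field; rewrite gt_eqF.
have : 0 <= u / v by rewrite divr_ge0// ltW.
set q := u / v => q0.
have : 0 <= (u - v) ^+ 2 * (q * (2 + q)).
  by rewrite mulr_ge0 ?sqr_ge0// mulr_ge0// addr_ge0.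
have : ((u - v) * (1 + q)) ^+ 2 = (u - v) ^+ 2 + (u - v) ^+ 2 * (q * (2 + q)).
  by ring.
have := sqr_ge0 (u - v - 1); have := sqr_ge0 (u - v + 1).
set y := (_ * (1 + q)) ^+ 2; set z := (u - v) ^+ 2 * (q * (2 + q)).
rewrite [(u - v + 1) ^+ 2]sqrrD1 [(u - v - 1) ^+ 2]sqrrB1 => h1 h2 h3 h4.
by rewrite ler_norml; apply/andP; split; lra.
Qed.

Lemma poisson_dist_bound (R : realType) (lam : R) : 0 < lam ->
  (poisson lam \x poisson lam)%E.-integrable setT
     (fun z => (`|z.1%:R - z.2%:R| : R)%:E) /\
  `|\int[(poisson lam \x poisson lam)%E]_z `|z.1%:R - z.2%:R|
    - 2 * Num.sqrt (lam / pi)| <= 2.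
Proof.
move=> lam0.
have M0 : 0 < 2 * lam by rewrite mulr_gt0.
set M := 2 * lam in M0.
have cE : 2 * Num.sqrt (lam / pi) = Num.sqrt (2 / pi) * Num.sqrt M.
  rewrite -sqrtrM ?divr_ge0 ?pi_ge0// /M.
  rewrite -[X in X * _](ger0_norm (ler0n R 2)) -sqrtr_sqr -sqrtrM ?exprn_ge0//.
  by congr Num.sqrt; ring.
have c01 : Num.sqrt (2 / pi) <= 1 :> R.
  rewrite -[leRHS]sqrtr1 ler_sqrt ?ler_pdivrMr ?mul1r ?pi_gt0 ?pi_ge2//.
have [iv vE] := poisson_variance R M M0.
(* Of the constant 3/2, 1 is the error of [mean_abs_walk_approx] and 1/2 comes from [sqrtr_dist_le].
   The variance being M, the quadratic term has mean 1/2, for a total of 2. *)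
pose g (N : nat) : R := (N%:R - M) ^+ 2 * (2 * M)^-1 + 3 / 2.
have ig1 : (poisson M).-integrable setT
    (EFin \o (fun N => (N%:R - M) ^+ 2 * (2 * M)^-1)).
  by apply: (eq_integrable measurableT _ _ _ (integrableZr measurableT (2 * M)^-1 iv)).
have ic (c : R) : (poisson M).-integrable setT (EFin \o (fun=> c)).
  exact: finite_measure_integrable_cst.
have ig : (poisson M).-integrable setT (EFin \o g).
  by apply: (eq_integrable measurableT _ _ _ (integrableD measurableT ig1 (ic _))).
have gE : \int[poisson M]_N g N = 2.
  rewrite RintegralD// RintegralZr// vE Rintegral_cst//.
  rewrite [X in fine X]probability_setT mulr1.
  by field; rewrite gt_eqF.
have close (N : nat) : `|mean_abs_walk N - 2 * Num.sqrt (lam / pi)| <= g N.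
  rewrite cE.
  have h1 := mean_abs_walk_approx R N.
  have h2 := sqrtr_dist_le R N%:R M (ler0n R N) M0.
  have c0 := sqrtr_ge0 (2 / pi : R).
  rewrite (le_trans (ler_distD (Num.sqrt (2 / pi) * Num.sqrt N%:R) _ _))//.
  rewrite -mulrBr normrM (ger0_norm c0).
  have : Num.sqrt (2 / pi) * `|Num.sqrt N%:R - Num.sqrt M| <= `|Num.sqrt N%:R - Num.sqrt M|.
    by rewrite ler_piMl.
  rewrite /g invfM mulrA [_ * 2^-1 * _]mulrAC.
  set D := (N%:R - M) ^+ 2 / M in h2 *. lra.
have wE : \int[(poisson lam \x poisson lam)%E]_z `|z.1%:R - z.2%:R|
    = \int[poisson M]_N mean_abs_walk N.
  by rewrite /Rintegral integral_poisson2_dist.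
have iw : (poisson M).-integrable setT (EFin \o mean_abs_walk).
  exact: (integrable_dist_le _ _ _ _ _ _ _ (measurable_fun_nat _ _ _) (ic _) ig close).
split.
  apply/integrableP; split; first exact: measurable_fun_natX.
  under eq_integral => z _ do rewrite /= normr_id.
  rewrite integral_poisson2_dist//.
  move/integrableP : iw => [_]; apply: le_lt_trans.
  apply: ge0_le_integral => //= N _; rewrite lee_fin ?ler_norm//.
  exact: mean_abs_walk_ge0.
rewrite wE.
have := Rintegral_dist_le _ _ _ _ _ _ _ (measurable_fun_nat _ _ _) (ic _) ig close.
by rewrite Rintegral_cst// [X in fine X]probability_setT mulr1 gE.
Qed.

(** * Taylor expansions on the half-line *)

Lemma has_derivative_on_is_derive (R : realType) (A : set R) (g g' : R -> R)
    (t : R) : nbhs t A -> has_derivative_on A g g' -> is_derive t 1 g (g' t).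
Proof.
move=> tA dg; have At : A t by exact: nbhs_singleton.
have C : h^-1 *: (g (h *: 1 + t) - g t) @[h --> 0^'] --> g' t.
  apply/cvgrPdist_le => e e0.
  have /cvgrPdist_le/(_ e e0) := dg t At.
  move=> /(@nbhs_ballP R R) [r /= r0 Hr].
  have /(@nbhs_ballP R R) [s /= s0 Hs] := tA.
  apply/(@nbhs_ballP R R); exists (Num.min r s) => /=; first by rewrite lt_min r0.
  move=> h; rewrite /ball/= sub0r normrN lt_min => /andP[hr hs] h0.
  have ht : h *: 1 + t = t + h by rewrite addrC /GRing.scale/= mulr1.
  have := Hr (t + h); rewrite /ball/= opprD addNKr normrN => /(_ hr).
  rewrite ht -[_ *: _]/(_ * _) [_^-1 * _]mulrC (addrC t h) addrK; apply.
    by rewrite -subr_eq0 addrK.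
  by apply: Hs; rewrite /ball/= opprD addrCA subrr addr0 normrN.
apply: DeriveDef; first by apply/cvg_ex; exists (g' t).
exact: cvg_lim C.
Qed.

(** The point t = 0 is included, as a Poisson variable vanishes with positive probability; there
    only continuity is asked. The bound on [|s - x|] keeps s inside any ball around x that contains
    t. *)
Lemma mean_value_nonneg (R : realType) (h dh : R -> R) (x t : R) :
  {within `[0, +oo[, continuous h} ->
  (forall s : R, 0 < s -> is_derive s 1 h (dh s)) -> 0 < x -> 0 <= t ->
  exists s : R, [/\ 0 < s, `|s - x| <= `|t - x| & h t - h x = dh s * (t - x)].
Proof.
move=> hc hd x0 t0.
have sub (a b : R) : 0 <= a -> `[a, b]%classic `<=` `[0, +oo[%classic.
  by move=> a0 s /=; rewrite !in_itv/= andbT => /andP[/(le_trans a0)].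
have [tx|xt|->] := ltgtP t x; last by exists x; rewrite !subrr mulr0 normr0.
- have [s|//|s] := @MVT R h dh t x tx.
  + by rewrite in_itv/= => /andP[ts _]; apply: hd; exact: le_lt_trans ts.
  + by apply: continuous_subspaceW hc; exact: sub.
  rewrite in_itv/= => /andP[ts sx] e; exists s; split.
  + exact: le_lt_trans ts.
  + by rewrite !ltr0_norm ?subr_lt0// lerN2 lerB// ltW.
  + by rewrite -opprB e -mulrN opprB.
- have [s|//|s] := @MVT R h dh x t xt.
  + by rewrite in_itv/= => /andP[ts _]; apply: hd; exact: lt_trans ts.
  + by apply: continuous_subspaceW hc; apply: sub; exact: ltW.
  rewrite in_itv/= => /andP[ts sx] e; exists s; split=> //.
  + exact: lt_trans ts.
  + by rewrite !gtr0_norm ?subr_gt0// lerB// ltW.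
Qed.

Lemma bounded_on_nonneg (R : realType) (g : R -> R) :
  [bounded g y | y in `[0, +oo[%classic] ->
  exists2 M : R, 0 <= M & forall y : R, 0 <= y -> `|g y| <= M.
Proof.
move=> /pinfty_ex_gt0 [M M0 HM]; exists M; first exact: ltW.
by move=> y y0; apply: HM => /=; rewrite in_itv/= y0.
Qed.

(** The bound M on f' gives the first estimate globally. For the second, differentiability of f at x
    gives the error e (t - x)^2 within some radius r; beyond r, the first estimate is enough,
    because (t - x)^2 <= (t - x)^4 / r^2. *)
Lemma Taylor_nonneg (R : realType) (F f f' : R -> R) (x : R) :
  continuous F -> has_derivative_on `[0, +oo[ F f ->
  has_derivative_on `[0, +oo[ f f' -> {within `[0, +oo[, continuous f} ->
  [bounded f' y | y in `[0, +oo[%classic] -> 0 < x ->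
  (exists2 M : R, 0 <= M &
    forall t : R, 0 <= t -> `|F t - (F x + f x * (t - x))| <= M * (t - x) ^+ 2) /\
  (forall e : R, 0 < e -> exists2 C : R, 0 <= C & forall t : R, 0 <= t ->
    `|F t - (F x + f x * (t - x) + f' x / 2 * (t - x) ^+ 2)| <=
      e * (t - x) ^+ 2 + C * (t - x) ^+ 4).
Proof.
move=> Fc dF df fc /bounded_on_nonneg [M M0 f'M] x0.
have nb (s : R) : 0 < s -> nbhs s (`[0, +oo[%classic : set R).
  by move=> /lt_nbhsr; apply: filterS => y y0; rewrite /= in_itv/= andbT ltW.
have near_x (e : R) : 0 < e -> exists2 r : R, 0 < r & forall s : R, 0 < s ->
    `|s - x| < r -> `|f s - f x - f' x * (s - x)| <= e * `|s - x|.
  move=> e0; have xA : `[0, +oo[%classic x by rewrite /= in_itv/= ltW.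
  have /cvgrPdist_le/(_ e e0) := df x xA.
  move=> /(@nbhs_ballP R R) [r /= r0 Hr]; exists r => // s s0 sxr.
  have [->|sx] := eqVneq s x; first by rewrite !subrr mulr0 subrr normr0 mulr0.
  have sx0 : s - x != 0 by rewrite subr_eq0.
  have := Hr s; rewrite /ball/= distrC => /(_ sxr sx).
  rewrite in_itv/= ltW// => /(_ isT) H.
  have -> : f s - f x - f' x * (s - x) = - (f' x - (f s - f x) / (s - x)) * (s - x).
    by field.
  by rewrite normrM normrN ler_wpM2r.
have {}dF (s : R) : 0 < s -> is_derive s 1 F (f s).
  by move=> s0; apply: has_derivative_on_is_derive dF; exact: nb.
have {}df (s : R) : 0 < s -> is_derive s 1 f (f' s).
  by move=> s0; apply: has_derivative_on_is_derive df; exact: nb.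
have flip s : 0 < s -> `|f s - f x| <= M * `|s - x|.
  move=> s0; have [r [r0 _ ->]] := mean_value_nonneg R f f' x s fc df x0 (ltW s0).
  by rewrite normrM ler_wpM2r// f'M// ltW.
have T1 t : 0 <= t -> `|F t - (F x + f x * (t - x))| <= M * (t - x) ^+ 2.
  move=> t0; pose h u := F u - f x * u.
  have dh (s : R) : 0 < s -> is_derive s 1 h (f s - f x).
    move=> s0; have := dF s s0 => ?.
    have -> : h = F - f x *: id by apply/funext.
    apply: is_derive_eq; rewrite ?fctE /GRing.scale/=; by rewrite mulr1.
  have hc : {within `[0, +oo[, continuous h}.
    apply: continuous_subspaceT => u; apply: cvgB; first exact: Fc.
    by apply: cvgM; [exact: cvg_cst|exact: cvg_id].
  have [s [s0 sx]] := mean_value_nonneg R h (fun s => f s - f x) x t hc dh x0 t0.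
  have -> : h t - h x = F t - (F x + f x * (t - x)) by rewrite /h; ring.
  move=> ->; rewrite normrM -[_ ^+ 2]real_normK ?num_real// expr2 mulrA.
  by rewrite ler_wpM2r// (le_trans (flip s s0))// ler_wpM2l.
split; first by exists M.
move=> e e0.
have [r r0 {}near_x] := near_x e e0.
(* Far from x, one M bounds the first order remainder and another covers the term [f' x / 2]. *)
have C0 : 0 <= 2 * M / r ^+ 2 by rewrite divr_ge0 ?sqr_ge0// mulr_ge0.
exists (2 * M / r ^+ 2) => //.
move=> t t0; have [tx|tx] := ltP `|t - x| r.
  (* The derivative of [h] is the first order remainder of f at x, which [near_x] controls; the mean
     value theorem supplies the second factor t - x. *)
  pose h u := F u - f x * u - f' x / 2 * (u - x) ^+ 2.
  have dh (s : R) : 0 < s -> is_derive s 1 h (f s - f x - f' x * (s - x)).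
    move=> s0; have := dF s s0 => ?.
    have -> : h = F - f x *: id - (f' x / 2) *: (id - cst x) ^+ 2.
      by apply/funext.
    apply: is_derive_eq; rewrite !fctE /GRing.scale/=.
    by field.
  have hc : {within `[0, +oo[, continuous h}.
    apply: continuous_subspaceT => u; apply: cvgB.
      apply: cvgB; first exact: Fc.
      by apply: cvgM; [exact: cvg_cst|exact: cvg_id].
    apply: cvgM; first exact: cvg_cst.
    by apply: cvgM; (apply: cvgB; [exact: cvg_id|exact: cvg_cst]).
  have [s [s0 sx]] := mean_value_nonneg R h _ x t hc dh x0 t0.
  have -> : h t - h x = F t - (F x + f x * (t - x) + f' x / 2 * (t - x) ^+ 2).
    by rewrite /h; ring.
  move=> ->; rewrite normrM.
  rewrite ler_wpDr ?(mulr_ge0 C0) ?exprn_even_ge0//.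
  rewrite -[_ ^+ 2]real_normK ?num_real// expr2 mulrA.
  rewrite ler_wpM2r// (le_trans (near_x s s0 (le_lt_trans sx tx)))//.
  by rewrite ler_wpM2l// ltW.
have r2 : 1 <= (t - x) ^+ 2 / r ^+ 2.
  rewrite ler_pdivlMr ?exprn_gt0// mul1r -[leRHS]real_normK ?num_real//.
  by rewrite lerXn2r// nnegrE ltW.
rewrite ler_wpDl ?(mulr_ge0 (ltW e0)) ?sqr_ge0//.
rewrite opprD addrA (le_trans (ler_normB _ _))//.
have h1 := T1 t t0; have h2 := f'M x (ltW x0).
have -> : 2 * M / r ^+ 2 * (t - x) ^+ 4 = (2 * M * (t - x) ^+ 2) * ((t - x) ^+ 2 / r ^+ 2).
  by rewrite (_ : 4%N = 2 + 2)%N// exprD; ring.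
have s2 : 0 <= (t - x) ^+ 2 by exact: sqr_ge0.
apply: (@le_trans _ _ (2 * M * (t - x) ^+ 2)); last first.
  by rewrite ler_peMr// mulr_ge0// mulr_ge0.
rewrite (_ : 2 * M * _ = M * (t - x) ^+ 2 + M * (t - x) ^+ 2); last by ring.
rewrite lerD// normrM (ger0_norm s2) ler_wpM2r// normrM.
rewrite (le_trans _ h2)// ler_piMr// ger0_norm// invf_le1//; lra.
Qed.

(** * Smoothing by Poisson weights *)

(** The second moment is of order 1/m and the fourth is O(1/m^2), which makes quartic remainders
    negligible against 1/m. *)
Lemma poisson_scaled_moments (R : realType) (m x : R) : 0 < m -> 0 < x ->
  [/\ (poisson (m * x)).-integrable setT (EFin \o (fun k => k%:R / m - x)),
      \int[poisson (m * x)]_k (k%:R / m - x) = 0,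
      (poisson (m * x)).-integrable setT
        (EFin \o (fun k => (k%:R / m - x) ^+ 2)) &
      \int[poisson (m * x)]_k (k%:R / m - x) ^+ 2 = x / m] /\
  (poisson (m * x)).-integrable setT (EFin \o (fun k => (k%:R / m - x) ^+ 4)) /\
  \int[poisson (m * x)]_k (k%:R / m - x) ^+ 4 = x / m ^+ 3 + 3 * x ^+ 2 / m ^+ 2.
Proof.
move=> m0 x0; have l0 : 0 < m * x by rewrite mulr_gt0.
have mn0 : m != 0 by rewrite gt_eqF.
have [i1 e1] := poisson_mean R _ l0.
have [i2 e2] := poisson_variance R _ l0.
have [i4 e4] := poisson_central_moment4 R _ l0.
have ic (c : R) : (poisson (m * x)).-integrable setT (EFin \o (fun=> c)).
  exact: finite_measure_integrable_cst.
have iZ (g : nat -> R) (c : R) :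
    (poisson (m * x)).-integrable setT (EFin \o g) ->
    (poisson (m * x)).-integrable setT (EFin \o (fun k => g k * c)).
  by move=> ig; apply: (eq_integrable measurableT _ _ _ (integrableZr measurableT c ig)).
have E n (k : nat) : (k%:R / m - x) ^+ n = (k%:R - m * x) ^+ n * m ^- n.
  by rewrite -exprVn -exprMn mulrBl mulrAC divff// mul1r.
split.
  split.
  - by apply: (eq_integrable measurableT _ _ _
      (integrableB measurableT (iZ _ m^-1 i1) (ic x))).
  - rewrite RintegralB//; last exact: iZ.
    rewrite RintegralZr// e1 Rintegral_cst// [X in fine X]probability_setT mulr1.
    by rewrite mulrAC divff// mul1r subrr.
  - by under eq_fun do rewrite E; exact: iZ.
  - under eq_Rintegral => k _ do rewrite E.
    by rewrite RintegralZr// e2; field.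
split; first by under eq_fun do rewrite E; exact: iZ.
under eq_Rintegral => k _ do rewrite E.
by rewrite RintegralZr// e4; field.
Qed.

Lemma integrable_fst d1 d2 (T1 : measurableType d1) (T2 : measurableType d2)
    (R : realType) (P1 : probability T1 R) (P2 : probability T2 R)
    (g : T1 -> R) : P1.-integrable setT (EFin \o g) ->
  (P1 \x P2)%E.-integrable setT (EFin \o (fun z => g z.1)).
Proof.
move=> ig; have mg := measurable_int _ ig.
apply/(integrable12ltyP P1 P2).
  by apply: (measurableT_comp mg); exact: measurable_fst.
have /integrableP[_] := ig; congr (_ < _)%E.
apply: eq_integral => t _ /=.
rewrite (integral_cst P2 measurableT `|g t|%:E).
by rewrite [X in (_ * X)%E]probability_setT mule1.
Qed.

Lemma Rintegral_fst d1 d2 (T1 : measurableType d1) (T2 : measurableType d2)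
    (R : realType) (P1 : probability T1 R) (P2 : probability T2 R)
    (g : T1 -> R) : P1.-integrable setT (EFin \o g) ->
  \int[(P1 \x P2)%E]_z g z.1 = \int[P1]_t g t.
Proof.
move=> ig; rewrite /Rintegral -(integral12_prod_meas1 (integrable_fst _ _ _ _ _ P1 P2 g ig)).
congr fine; apply: eq_integral => t _; rewrite /fubini_F/=.
rewrite (integral_cst P2 measurableT (g t)%:E).
by rewrite [X in (_ * X)%E]probability_setT mule1.
Qed.

Lemma integrable_snd d1 d2 (T1 : measurableType d1) (T2 : measurableType d2)
    (R : realType) (P1 : probability T1 R) (P2 : probability T2 R)
    (g : T2 -> R) : P2.-integrable setT (EFin \o g) ->
  (P1 \x P2)%E.-integrable setT (EFin \o (fun z => g z.2)).
Proof.
move=> ig; have mg := measurable_int _ ig.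
apply/(integrable21ltyP P1 P2).
  by apply: (measurableT_comp mg); exact: measurable_snd.
have /integrableP[_] := ig; congr (_ < _)%E.
apply: eq_integral => t _ /=.
rewrite (integral_cst P1 measurableT `|g t|%:E).
by rewrite [X in (_ * X)%E]probability_setT mule1.
Qed.

Lemma Rintegral_snd d1 d2 (T1 : measurableType d1) (T2 : measurableType d2)
    (R : realType) (P1 : probability T1 R) (P2 : probability T2 R)
    (g : T2 -> R) : P2.-integrable setT (EFin \o g) ->
  \int[(P1 \x P2)%E]_z g z.2 = \int[P2]_t g t.
Proof.
move=> ig; rewrite /Rintegral -(integral21_prod_meas1 (integrable_snd _ _ _ _ _ P1 P2 g ig)).
congr fine; apply: eq_integral => t _; rewrite /fubini_G/=.
rewrite (integral_cst P1 measurableT (g t)%:E).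
by rewrite [X in (_ * X)%E]probability_setT mule1.
Qed.

(** [szasz_mean] and [szasz_min_mean] are the S and A of the overview. *)
Definition szasz_mean {R : realType} (F : R -> R) (m x : R) : R :=
  \int[poisson (m * x)]_k F (k%:R / m).

Definition szasz_min_mean {R : realType} (F : R -> R) (m x : R) : R :=
  \int[(poisson (m * x) \x poisson (m * x))%E]_z
    F (Num.min (z.1%:R / m) (z.2%:R / m)).

(** The linear term has mean zero, so only the quadratic remainder counts. This is precise enough to
    replace S^2 by F(x)^2 in the variance, where errors of order 1/m are allowed. *)
Lemma szasz_mean_dist (R : realType) (F : R -> R) (m x a M : R) :
  0 < m -> 0 < x ->
  (forall t : R, 0 <= t -> `|F t - (F x + a * (t - x))| <= M * (t - x) ^+ 2) ->
  `|szasz_mean F m x - F x| <= M * (x / m).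
Proof.
move=> m0 x0 FM.
have [[i1 e1 i2 e2] _] := poisson_scaled_moments R m x m0 x0.
have ic (c : R) : (poisson (m * x)).-integrable setT (EFin \o (fun=> c)).
  exact: finite_measure_integrable_cst.
have iZ (g : nat -> R) (c : R) :
    (poisson (m * x)).-integrable setT (EFin \o g) ->
    (poisson (m * x)).-integrable setT (EFin \o (fun k => c * g k)).
  by move=> ig; apply: (eq_integrable measurableT _ _ _ (integrableZl measurableT c ig)).
have ih : (poisson (m * x)).-integrable setT
    (EFin \o (fun k => F x + a * (k%:R / m - x))).
  by apply: (eq_integrable measurableT _ _ _
    (integrableD measurableT (ic (F x)) (iZ _ a i1))).
have km0 (k : nat) : 0 <= k%:R / m by rewrite divr_ge0// ltW.
have := Rintegral_dist_le _ _ _ _ _ _ _ (measurable_fun_nat _ _ _) ih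
  (iZ _ M i2) (fun k => FM _ (km0 k)).
rewrite RintegralD//; last exact: iZ.
rewrite !RintegralZl// e1 e2 mulr0 addr0 Rintegral_cst//.
by rewrite [X in fine X]probability_setT mulr1.
Qed.

Lemma szasz_mean_Voronovskaya (R : realType) (F : R -> R) (x a b : R) : 0 < x ->
  (forall e : R, 0 < e -> exists2 C : R, 0 <= C & forall t : R, 0 <= t ->
    `|F t - (F x + a * (t - x) + b / 2 * (t - x) ^+ 2)| <=
      e * (t - x) ^+ 2 + C * (t - x) ^+ 4) ->
  forall e : R, 0 < e -> exists2 N : R, 0 < N & forall m : R, N <= m ->
    `|szasz_mean F m x - F x - x * b / 2 / m| <= e / m.
Proof.
move=> x0 FT e e0.
(* The second moment x/m turns this accuracy into e / (2m). The other half of e absorbs the quartic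
   term, which for m >= 1 is at most K / m^2. *)
have e2x : 0 < e / (2 * x) by rewrite divr_gt0// mulr_gt0.
have [C C0 FC] := FT _ e2x.
pose K := C * (x + 3 * x ^+ 2).
have K0 : 0 <= K by rewrite mulr_ge0// addr_ge0 ?mulr_ge0 ?sqr_ge0// ltW.
have Ke : 0 <= 2 * K / e by rewrite divr_ge0 ?(ltW e0)// mulr_ge0.
(* The summand 1 ensures m >= 1, and 2K/e ensures K / m <= e / 2. *)
exists (1 + 2 * K / e) => [|m Nm]; first by rewrite ltr_pwDl.
have m1 : 1 <= m.
  by rewrite (le_trans _ Nm)// lerDl.
have m0 : 0 < m by exact: lt_le_trans m1.
have [[i1 e1 i2 e2] [i4 e4]] := poisson_scaled_moments R m x m0 x0.
have ic (c : R) : (poisson (m * x)).-integrable setT (EFin \o (fun=> c)).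
  exact: finite_measure_integrable_cst.
have iZ (g : nat -> R) (c : R) :
    (poisson (m * x)).-integrable setT (EFin \o g) ->
    (poisson (m * x)).-integrable setT (EFin \o (fun k => c * g k)).
  by move=> ig; apply: (eq_integrable measurableT _ _ _ (integrableZl measurableT c ig)).
have iD (g h : nat -> R) :
    (poisson (m * x)).-integrable setT (EFin \o g) ->
    (poisson (m * x)).-integrable setT (EFin \o h) ->
    (poisson (m * x)).-integrable setT (EFin \o (fun k => g k + h k)).
  by move=> ig ih; apply: (eq_integrable measurableT _ _ _ (integrableD measurableT ig ih)).
have ih1 := iD _ _ (ic (F x)) (iZ _ a i1).
have ih := iD _ _ ih1 (iZ _ (b / 2) i2).
have ig := iD _ _ (iZ _ (e / (2 * x)) i2) (iZ _ C i4).
have km0 (k : nat) : 0 <= k%:R / m by rewrite divr_ge0// ltW.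
have := Rintegral_dist_le _ _ _ _ _ _ _ (measurable_fun_nat _ _ _) ih ig
  (fun k => FC _ (km0 k)).
rewrite !(RintegralD _ ih1, RintegralD _ (ic _), RintegralD)//; do ?exact: iZ.
rewrite !RintegralZl// e1 e2 e4 mulr0 addr0 Rintegral_cst//.
rewrite [X in fine X]probability_setT mulr1 -/(szasz_mean F m x).
rewrite opprD addrA (_ : b / 2 * (x / m) = x * b / 2 / m); last by field; rewrite gt_eqF.
move=> /le_trans; apply.
have xn0 : x != 0 by rewrite gt_eqF.
have mn0 : m != 0 by rewrite gt_eqF.
have -> : e / (2 * x) * (x / m) = e / 2 / m.
  by field; rewrite ?xn0 ?mn0.
have -> : C * (x / m ^+ 3 + 3 * x ^+ 2 / m ^+ 2) =
    (C * (x / m + 3 * x ^+ 2)) / m / m by field.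
rewrite -mulrDl ler_wpM2r ?invr_ge0 ?(ltW m0)//.
have h1 : C * (x / m + 3 * x ^+ 2) <= K.
  by rewrite ler_wpM2l// lerD2r ler_pdivrMr// ler_peMr// ltW.
have h2 : C * (x / m + 3 * x ^+ 2) / m <= e / 2.
  rewrite ler_pdivrMr// (le_trans h1)//.
  apply: (@le_trans _ _ (e / 2 * (1 + 2 * K / e))); last by rewrite ler_wpM2l// divr_ge0// ltW.
  have -> : e / 2 * (1 + 2 * K / e) = e / 2 + K by field; rewrite gt_eqF.
  lra.
lra.
Qed.

(** Since 2 (min(u, v) - x) = (u - x) + (v - x) - |u - v|, only the mean distance survives from the
    linear term. The quadratic remainder is at most M times the sum of both squares, hence 2 M x /
    m; the error 2 in the mean distance, multiplied by |a| / (2m), gives |a| / m. *)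
Lemma szasz_min_mean_dist (R : realType) (F : R -> R) (m x a M : R) :
  0 < m -> 0 < x -> 0 <= M ->
  (forall t : R, 0 <= t -> `|F t - (F x + a * (t - x))| <= M * (t - x) ^+ 2) ->
  `|szasz_min_mean F m x - F x + a * Num.sqrt (x / pi) / Num.sqrt m| <=
    (2 * M * x + `|a|) / m.
Proof.
move=> m0 x0 M0 FM; set mu := poisson (m * x).
have [[i1 e1 i2 e2] _] := poisson_scaled_moments R m x m0 x0.
have [iA] := poisson_dist_bound R (m * x) (mulr_gt0 m0 x0).
set D := (X in `|X - _|) => DA.
have mn0 : m != 0 by rewrite gt_eqF.
pose mu2 : probability _ R := (mu \x mu)%E.
have ic (c : R) : mu2.-integrable setT (EFin \o (fun=> c)).
  exact: finite_measure_integrable_cst.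
have iZ (g : nat * nat -> R) (c : R) : mu2.-integrable setT (EFin \o g) ->
    mu2.-integrable setT (EFin \o (fun k => c * g k)).
  by move=> ig; apply: (eq_integrable measurableT _ _ _ (integrableZl measurableT c ig)).
have iD (g h : nat * nat -> R) :
    mu2.-integrable setT (EFin \o g) -> mu2.-integrable setT (EFin \o h) ->
    mu2.-integrable setT (EFin \o (fun k => g k + h k)).
  by move=> ig ih; apply: (eq_integrable measurableT _ _ _ (integrableD measurableT ig ih)).
have if1 := integrable_fst _ _ _ _ _ mu mu _ i1.
have is1 := integrable_snd _ _ _ _ _ mu mu _ i1.
have if2 := integrable_fst _ _ _ _ _ mu mu _ i2.
have is2 := integrable_snd _ _ _ _ _ mu mu _ i2.
have i12 := iD _ _ if1 is1.
have i12A := iD _ _ i12 (iZ _ (- m^-1) iA).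
have ih := iD _ _ (ic (F x)) (iZ _ (a / 2) i12A).
have ig := iZ _ M (iD _ _ if2 is2).
have km0 (k : nat) : 0 <= k%:R / m by rewrite divr_ge0// ltW.
have close (z : nat * nat) :
   `|F (Num.min (z.1%:R / m) (z.2%:R / m)) -
     (F x + a / 2 * (z.1%:R / m - x + (z.2%:R / m - x) +
        - m^-1 * `|z.1%:R - z.2%:R|))| <=
     M * ((z.1%:R / m - x) ^+ 2 + (z.2%:R / m - x) ^+ 2).
  set u := z.1%:R / m; set v := z.2%:R / m.
  have -> : u - x + (v - x) + - m^-1 * `|z.1%:R - z.2%:R| = 2 * (Num.min u v - x).
    have -> : - m^-1 * `|z.1%:R - z.2%:R| = - `|u - v| :> R.
      by rewrite -mulrBl normrM mulNr mulrC [`|m^-1|]gtr0_norm// invr_gt0.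
    by have [uv|vu] := leP u v;
      [rewrite ler0_norm ?subr_le0//|rewrite gtr0_norm ?subr_gt0//]; ring.
  rewrite mulrA divfK ?pnatr_eq0//.
  have uv0 : 0 <= Num.min u v by rewrite le_min !km0.
  rewrite (le_trans (FM _ uv0))// ler_wpM2l//.
  by case: (leP u v) => _; rewrite ?lerDl ?lerDr sqr_ge0.
have := Rintegral_dist_le _ _ _ _ _ _ _ (measurable_fun_natX _ _ _) ih ig close.
have pr1 : fine (mu2 setT) = 1 by rewrite probability_setT.
rewrite (RintegralD measurableT (ic _) (iZ _ _ i12A)).
rewrite (RintegralZl _ measurableT i12A) (RintegralD measurableT i12 (iZ _ _ iA)).
rewrite (RintegralD measurableT if1 is1) (RintegralZl _ measurableT iA).
rewrite (RintegralZl _ measurableT (iD _ _ if2 is2)) (RintegralD measurableT if2 is2).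
rewrite (Rintegral_fst _ _ _ _ _ mu mu _ i1) (Rintegral_snd _ _ _ _ _ mu mu _ i1).
rewrite (Rintegral_fst _ _ _ _ _ mu mu _ i2) (Rintegral_snd _ _ _ _ _ mu mu _ i2).
rewrite e1 e2 Rintegral_cst// pr1 mulr1 add0r -/(szasz_min_mean F m x) -/D => H.
set c := a * _ / _.
have cE : c = a / (2 * m) * (2 * Num.sqrt (m * x / pi)).
  rewrite -[m * x / pi]mulrA (sqrtrM _ (ltW m0)) /c.
  have s0 : Num.sqrt m != 0 by rewrite gt_eqF ?sqrtr_gt0.
  rewrite -[in a / (2 * m)](sqr_sqrtr (ltW m0)).
  by set s := Num.sqrt m in s0 *; field.
(* The error made by replacing the mean distance with its approximation. *)
pose E := a / (2 * m) * (D - 2 * Num.sqrt (m * x / pi)).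
have -> : szasz_min_mean F m x - F x + c =
   szasz_min_mean F m x - (F x + a / 2 * (0 + - m^-1 * D)) - E.
  by rewrite cE /E; field.
rewrite (le_trans (ler_normB _ _))//.
have HE : `|E| <= `|a| / m.
  rewrite /E normrM normrM (_ : `|(2 * m)^-1| = m^-1 / 2); last first.
    by rewrite gtr0_norm ?invr_gt0 ?mulr_gt0//; field.
  set q := `|D - _| in DA *; rewrite -!mulrA ler_wpM2l// ler_piMr ?invr_ge0 ?(ltW m0)//.
  by rewrite mulrC ler_pdivrMr// mul1r.
have -> : (2 * M * x + `|a|) / m = M * (x / m + x / m) + `|a| / m by field.
exact: lerD.
Qed.

(** * Poisson mixtures of random variables *)

(** The Poisson integral is a series of nonnegative terms, so monotone convergence exchanges it with
    [mu]; measurability is asked one index at a time. *)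
Lemma integral_poisson_swap d (T : measurableType d) (R : realType)
    (mu : {measure set T -> \bar R}) (lam : R) (u : T -> nat -> \bar R) :
  0 < lam -> (forall k, measurable_fun setT (u ^~ k)) ->
  (forall w k, 0 <= u w k)%E ->
  measurable_fun setT (fun w => \int[poisson lam]_k u w k)%E /\
  (\int[mu]_w \int[poisson lam]_k u w k = \int[poisson lam]_k \int[mu]_w u w k)%E.
Proof.
move=> lam0 mu_ u0.
have p0 k w : (0 <= (poisson_pmf lam k)%:E * u w k)%E.
  by rewrite mule_ge0 ?lee_fin ?poisson_pmf_ge0.
have mp k : measurable_fun setT (fun w => (poisson_pmf lam k)%:E * u w k)%E.
  exact: measurable_funeM.
have -> : (fun w => \int[poisson lam]_k u w k)%E =
    (fun w => \sum_(k <oo) (poisson_pmf lam k)%:E * u w k)%E.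
  by apply/funext => w; rewrite integral_poisson.
split.
  by apply: (ge0_emeasurable_sum (P := xpredT)) => [k w _ _|k _].
rewrite integral_nneseries//= integral_poisson//; last first.
  by move=> k; exact: integral_ge0.
apply: eq_eseriesr => k _.
by rewrite ge0_integralZl_EFin ?poisson_pmf_ge0.
Qed.

Lemma integrable_unit_interval d (T : measurableType d) (R : realType)
    (P : probability T R) (g : T -> R) :
  measurable_fun setT g -> (forall w, 0 <= g w <= 1) ->
  P.-integrable setT (EFin \o g).
Proof.
move=> mg g01.
have ic (c : R) : P.-integrable setT (EFin \o (fun=> c)).
  exact: finite_measure_integrable_cst.
apply: (integrable_dist_le _ _ _ _ _ _ _ mg (ic 0) (ic 1)) => w.
by rewrite subr0 ger0_norm; case/andP : (g01 w).
Qed.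

Lemma Rintegral_unit_interval d (T : measurableType d) (R : realType)
    (P : probability T R) (g : T -> R) :
  measurable_fun setT g -> (forall w, 0 <= g w <= 1) ->
  0 <= \int[P]_w g w <= 1.
Proof.
move=> mg g01; apply/andP; split.
  by apply: Rintegral_ge0 => w _; case/andP : (g01 w).
have <- : \int[P]_w (1 : R) = 1.
  by rewrite Rintegral_cst// [X in fine X]probability_setT mulr1.
apply: le_Rintegral => //; first exact: integrable_unit_interval.
  exact: finite_measure_integrable_cst.
by move=> w _; case/andP : (g01 w).
Qed.

Lemma EFin_Rintegral d (T : measurableType d) (R : realType)
    (P : {measure set T -> \bar R}) (g : T -> R) :
  P.-integrable setT (EFin \o g) ->
  ((\int[P]_w g w)%:E = \int[P]_w (g w)%:E)%E.
Proof. by move=> ig; rewrite fineK// integrable_fin_num. Qed.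

(** Squaring a Poisson mean amounts to averaging over two independent copies, which is how the
    product measure enters. *)
Lemma poisson_mixture_moments d (T : measurableType d) (R : realType)
    (P : probability T R) (lam : R) (e : T -> nat -> R) (c1 : nat -> R)
    (c2 : nat -> nat -> R) :
  0 < lam -> (forall k, measurable_fun setT (e ^~ k)) ->
  (forall w k, 0 <= e w k <= 1) ->
  (forall k, \int[P]_w (e w k)%:E = (c1 k)%:E)%E ->
  (forall k l, \int[P]_w (e w k * e w l)%:E = (c2 k l)%:E)%E ->
  let K w := \int[poisson lam]_k e w k in
  [/\ measurable_fun setT K, forall w, 0 <= K w <= 1,
      (\int[P]_w (K w)%:E = \int[poisson lam]_k (c1 k)%:E)%E &
      (\int[P]_w (K w ^+ 2)%:E =
        \int[poisson lam \x poisson lam]_z (c2 z.1 z.2)%:E)%E].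
Proof.
move=> lam0 me e01 H1 H2 K.
have ie w : (poisson lam).-integrable setT (EFin \o e w).
  by apply: integrable_unit_interval.
have e0 w k : (0 <= (e w k)%:E)%E by rewrite lee_fin; case/andP : (e01 w k).
have KE w : ((K w)%:E = \int[poisson lam]_k (e w k)%:E)%E by exact: EFin_Rintegral.
have [mK intK] := integral_poisson_swap _ _ _ P _ (fun w k => (e w k)%:E) lam0
  (fun k => (measurable_EFinP _ _).2 (me k)) e0.
have K01 w : 0 <= K w <= 1 by exact: Rintegral_unit_interval.
have mK' : measurable_fun setT K.
  by apply/measurable_EFinP; rewrite (_ : EFin \o K = fun w =>
    \int[poisson lam]_k (e w k)%:E)%E//; apply/funext => w /=.
split=> //.
  under eq_integral => w _ do rewrite KE.
  by rewrite intK; apply: eq_integral => k _; rewrite H1.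
have c20 k l : 0 <= c2 k l.
  by rewrite -lee_fin -H2; apply: integral_ge0 => w _; rewrite EFinM mule_ge0.
rewrite fubini_tonelli1/=; last 2 first.
- exact: measurable_fun_natX.
- by move=> z; rewrite lee_fin.
have eK k w : ((e w k * K w)%:E = \int[poisson lam]_l (e w k * e w l)%:E)%E.
  rewrite EFinM KE -ge0_integralZl_EFin//; last by case/andP : (e01 w k).
(* One factor of the square is expanded and exchanged with [P] while the other stays whole; [eK]
   then expands the second one. *)
transitivity (\int[P]_w \int[poisson lam]_k (e w k * K w)%:E)%E.
  apply: eq_integral => w _; rewrite expr2 EFinM {1}KE muleC.
  rewrite -ge0_integralZl_EFin//; last by case/andP : (K01 w).
  by apply: eq_integral => k _; rewrite mulrC EFinM.
have [|w k|_ ->] := integral_poisson_swap _ _ _ P _ (fun w k => (e w k * K w)%:E) lam0.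
- by move=> k; apply/measurable_EFinP; exact: measurable_funM.
- by rewrite EFinM mule_ge0// lee_fin; case/andP : (K01 w).
apply: eq_integral => k _; rewrite /fubini_F/=.
under eq_integral => w _ do rewrite eK.
have [|w l|_ ->] := integral_poisson_swap _ _ _ P _ (fun w l => (e w k * e w l)%:E) lam0.
- by move=> l; apply/measurable_EFinP; exact: measurable_funM.
- by rewrite EFinM mule_ge0.
by apply: eq_integral => l _; rewrite H2.
Qed.

(** The value of [limn] is meaningful only for a convergent sequence; here the partial sums are
    nondecreasing and bounded by the finite integral. *)
Lemma Rintegral_poisson_series (R : realType) (lam : R) (h : nat -> R) :
  0 < lam -> (forall k, 0 <= h k <= 1) ->
  limn (series (fun k => h k * (expR (- lam) * (lam ^+ k / k`!%:R)))) =
  \int[poisson lam]_k h k.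
Proof.
move=> lam0 h01.
have h0 k : 0 <= h k by case/andP : (h01 k).
have ih : (poisson lam).-integrable setT (EFin \o h).
  exact: integrable_unit_interval.
pose u k := h k * (expR (- lam) * (lam ^+ k / k`!%:R)).
have u0 k : 0 <= u k.
  rewrite /u mulr_ge0// mulr_ge0 ?expR_ge0// divr_ge0//.
  by rewrite exprn_ge0// ltW.
have sE : (\int[poisson lam]_k (h k)%:E = \sum_(k <oo) (u k)%:E)%E.
  rewrite integral_poisson//.
  apply: eq_eseriesr => k _; rewrite -EFinM; congr EFin.
  by rewrite /u /poisson_pmf lam0; ring.
apply: EFin_inj; rewrite EFin_Rintegral// sE -EFin_lim; last first.
  apply: nondecreasing_is_cvgn.
    by apply: nondecreasing_series => k _ _; exact: u0.
  exists (fine (\sum_(k <oo) (u k)%:E)%E) => _ [n _ <-].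
  rewrite -lee_fin fineK; last by rewrite -sE; exact: integrable_fin_num.
  rewrite /series/= -sumEFin; apply: nneseries_lim_ge => k _ _.
  by rewrite lee_fin; exact: u0.
by apply/congr_lim/funext => n; rewrite /series/= -sumEFin.
Qed.

(** * Moments of the estimator *)

Lemma empirical_cdf_unit (R : realType) (xs : nat -> R) (n : nat) (s : R) :
  0 <= empirical_cdf xs n s <= 1.
Proof.
rewrite /empirical_cdf; case: n => [|n]; first by rewrite big_ord0 mulr0 lexx/=.
rewrite mulr_ge0 ?sumr_ge0//= mulrC ler_pdivrMr// mul1r.
rewrite -[leRHS]mulr1 -[n.+1 in leRHS]card_ord mulr_natl -sumr_const.
by apply: ler_sum => i _; rewrite lern1 leq_b1.
Qed.

Lemma indic_le (R : realType) T (X : T -> R) (s : R) (w : T) :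
  (X w <= s)%R%:R = \1_(X @^-1` `]-oo, s]) w :> R.
Proof.
rewrite indicE; congr (nat_of_bool _)%:R.
by apply/idP/idP; rewrite inE /= in_itv.
Qed.

Lemma measurable_empirical_cdf d (T : measurableType d) (R : realType)
    (P : probability T R) (X : nat -> {RV P >-> R}) (n : nat) (s : R) :
  measurable_fun setT (fun w => empirical_cdf (fun i => X i w) n s).
Proof.
rewrite /empirical_cdf; apply: measurable_funM; first exact: measurable_cst.
apply: measurable_sum => i.
rewrite (_ : (fun w => _) = \1_(X i @^-1` `]-oo, s])).
  by apply: measurable_indic; apply: measurable_funPTI.
by apply/funext => w; rewrite indic_le.
Qed.

Lemma integral_empirical_cdf d (T : measurableType d) (R : realType)
    (P : probability T R) (X : nat -> {RV P >-> R}) (F : R -> R) (n : nat) (s : R) :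
  (forall i y, cdf (X i) y = (F y)%:E) -> (0 < n)%N ->
  (\int[P]_w (empirical_cdf (fun i => X i w) n s)%:E = (F s)%:E)%E.
Proof.
move=> Xcdf n0.
have mA i : measurable (X i @^-1` `]-oo, s]) by apply: measurable_funPTI.
transitivity (\int[P]_w (n%:R^-1%:E * \sum_(i < n) (\1_(X i @^-1` `]-oo, s]) w)%:E))%E.
  apply: eq_integral => w _; rewrite sumEFin -EFinM; congr (_ * _)%:E.
  by apply: eq_bigr => i _; rewrite indic_le.
rewrite ge0_integralZl_EFin//; last 2 first.
- by move=> w _; rewrite sume_ge0// => i _; rewrite lee_fin.
- by apply: emeasurable_sum => i; apply/measurable_EFinP; exact: measurable_indic.
rewrite ge0_integral_sum//; last first.
  by move=> i; apply/measurable_EFinP; exact: measurable_indic.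
rewrite (eq_bigr (fun=> (F s)%:E)); last first.
  by move=> i _; rewrite integral_indic// setIT; exact: Xcdf.
rewrite sumEFin sumr_const card_ord -EFinM -[F s *+ n]mulr_natl mulrA mulVf ?mul1r//.
by rewrite pnatr_eq0 -lt0n.
Qed.

(** Among the n^2 pairs of indices, the n diagonal ones contribute F(min(s, t)), because X_i <= s
    and X_i <= t is a single event; the n (n - 1) others factor by independence. *)
Lemma integral_empirical_cdf_mul d (T : measurableType d) (R : realType)
    (P : probability T R) (X : nat -> {RV P >-> R}) (F : R -> R) (n : nat)
    (s t : R) :
  mutually_independent X -> (forall i y, cdf (X i) y = (F y)%:E) -> (0 < n)%N ->
  (\int[P]_w (empirical_cdf (fun i => X i w) n s *
              empirical_cdf (fun i => X i w) n t)%:E =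
   (n%:R^-1 * F (Num.min s t) + (1 - n%:R^-1) * (F s * F t))%:E)%E.
Proof.
move=> Xind Xcdf n0.
pose A i s := X i @^-1` `]-oo, s].
have mA i u : measurable (A i u) by apply: measurable_funPTI.
have PA i u : P (A i u) = (F u)%:E by exact: Xcdf.
have PAA (i j : 'I_n) : P (A i s `&` A j t) =
    (if i == j then F (Num.min s t) else F s * F t)%:E.
  have [->|ij] := eqVneq i j.
    rewrite -(PA j); congr (P _); apply/seteqP; split=> w /=;
      rewrite /A/= !in_itv/= le_min; [by move=> [-> ->]|by move=> /andP].
  (* Independence of the pair i, j, with the half-line up to s for i and the one up to t for every
     other index. *)
  have := Xind [:: nat_of_ord i; nat_of_ord j]
    (fun l => if l == i then `]-oo, s]%classic else `]-oo, t]%classic).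
  rewrite /= inE (inj_eq val_inj) ij => /(_ isT)/(_ _)/wrap[].
    by move=> l; case: ifP.
  rewrite big_cons big_seq1 eqxx (inj_eq val_inj) eq_sym (negbTE ij) -/(A i s) -/(A j t).
  rewrite !PA -EFinM => <-; congr (P _); apply/seteqP; split.
    move=> w [Ai Aj] l /=; rewrite !inE => /orP[] /eqP ->.
      by rewrite eqxx.
    by rewrite (inj_eq val_inj) eq_sym (negbTE ij).
  move=> w H; split.
    by have := H (nat_of_ord i); rewrite /= !inE !eqxx => /(_ isT).
  have := H (nat_of_ord j); rewrite /= !inE eqxx orbT => /(_ isT).
  by rewrite (inj_eq val_inj) eq_sym (negbTE ij).
have m1 (i j : 'I_n) : measurable_fun setT (EFin \o \1_(A i s `&` A j t) : T -> \bar R).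
  by apply/measurable_EFinP; apply: measurable_indic; exact: measurableI.
transitivity (\int[P]_w ((n%:R^-1 * n%:R^-1)%:E *
    \sum_(i < n) \sum_(j < n) (\1_(A i s `&` A j t) w)%:E))%E.
  apply: eq_integral => w _.
  under eq_bigr do rewrite sumEFin.
  rewrite sumEFin -EFinM; congr EFin; rewrite /empirical_cdf mulrACA; congr (_ * _).
  rewrite big_distrlr/=; apply: eq_bigr => i _; apply: eq_bigr => j _.
  by rewrite !indic_le indicI.
rewrite ge0_integralZl_EFin//; last 2 first.
- by move=> w _; rewrite sume_ge0// => i _; rewrite sume_ge0// => j _; rewrite lee_fin.
- by apply: emeasurable_sum => i; apply: emeasurable_sum => j; exact: m1.
rewrite ge0_integral_sum//; last 2 first.
- by move=> i; apply: emeasurable_sum => j; exact: m1.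
- by move=> i w _; rewrite sume_ge0// => j _; rewrite lee_fin.
rewrite (eq_bigr (fun i : 'I_n => (F (Num.min s t) + n.-1%:R * (F s * F t))%:E)); last first.
  move=> i _; rewrite ge0_integral_sum//; last by move=> j; exact: m1.
  rewrite (eq_bigr (fun j : 'I_n => (if i == j then F (Num.min s t) else F s * F t)%:E)); last first.
    move=> j _; rewrite integral_indic//; last exact: measurableI.
    by rewrite setIT; exact: PAA.
  rewrite sumEFin (bigD1 i)//= eqxx; congr (_ + _)%:E.
  rewrite (eq_bigr (fun=> F s * F t)); last first.
    by move=> j ji; rewrite eq_sym (negbTE ji).
  by rewrite sumr_const cardC1 card_ord mulr_natl.
rewrite sumEFin sumr_const card_ord -EFinM -[_ *+ n]mulr_natl; congr EFin.
have nn0 : (n%:R : R) != 0 by rewrite pnatr_eq0 -lt0n.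
have -> : n.-1%:R = n%:R - 1 :> R by rewrite -subn1 natrB.
by field.
Qed.

Lemma Rintegral_prod_mul d1 d2 (T1 : measurableType d1) (T2 : measurableType d2)
    (R : realType) (P1 : probability T1 R) (P2 : probability T2 R)
    (g : T1 -> R) (h : T2 -> R) :
  measurable_fun setT g -> measurable_fun setT h ->
  (forall t, 0 <= g t <= 1) -> (forall t, 0 <= h t <= 1) ->
  \int[(P1 \x P2)%E]_z (g z.1 * h z.2) = (\int[P1]_t g t) * \int[P2]_t h t.
Proof.
move=> mg mh g01 h01.
have ih : P2.-integrable setT (EFin \o h) by exact: integrable_unit_interval.
have ig : P1.-integrable setT (EFin \o g) by exact: integrable_unit_interval.
have h0 t : 0 <= h t by case/andP : (h01 t).
have g0 t : 0 <= g t by case/andP : (g01 t).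
rewrite /Rintegral fubini_tonelli1/=; last 2 first.
- by apply/measurable_EFinP; apply: measurable_funM;
    [apply: (measurableT_comp mg)|apply: (measurableT_comp mh)].
- by move=> z; rewrite lee_fin mulr_ge0.
rewrite -fineM ?integrable_fin_num//; congr fine.
have H0 : (0 <= \int[P2]_u (h u)%:E)%E.
  by apply: integral_ge0 => u _; rewrite lee_fin.
have mgE : measurable_fun setT (fun t => (g t)%:E) by exact/measurable_EFinP.
have mhE : measurable_fun setT (fun t => (h t)%:E) by exact/measurable_EFinP.
have gE t : setT t -> (0 <= (g t)%:E)%E by rewrite lee_fin.
have hE t : setT t -> (0 <= (h t)%:E)%E by rewrite lee_fin.
rewrite -(ge0_integralZr P1 measurableT mgE gE H0).
apply: eq_integral => t _.
by rewrite -(ge0_integralZl_EFin P2 measurableT hE mhE (g0 t)).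
Qed.

Lemma expectation_sqr_dist d (T : measurableType d) (R : realType)
    (P : probability T R) (Y : T -> R) (c : R) :
  measurable_fun setT Y -> (forall w, 0 <= Y w <= 1) ->
  'E_P[(fun w => (Y w - c) ^+ 2)%R]%E =
  (\int[P]_w Y w ^+ 2 - 2 * c * \int[P]_w Y w + c ^+ 2)%:E.
Proof.
move=> mY Y01.
have iY : P.-integrable setT (EFin \o Y) by exact: integrable_unit_interval.
have iY2 : P.-integrable setT (EFin \o (fun w => Y w ^+ 2)).
  apply: integrable_unit_interval; first exact: measurable_funX.
  by move=> w; have /andP[y0 y1] := Y01 w; rewrite exprn_ge0// exprn_ile1.
have ic : P.-integrable setT (EFin \o (fun=> c ^+ 2)).
  exact: finite_measure_integrable_cst.
have iZ : P.-integrable setT (EFin \o (fun w => 2 * c * Y w)).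
  by apply: (eq_integrable measurableT _ _ _ (integrableZl measurableT (2 * c) iY)).
have iB : P.-integrable setT (EFin \o (fun w => Y w ^+ 2 - 2 * c * Y w)).
  by apply: (eq_integrable measurableT _ _ _ (integrableB measurableT iY2 iZ)).
have iD : P.-integrable setT (EFin \o (fun w => (Y w ^+ 2 - 2 * c * Y w) + c ^+ 2)).
  by apply: (eq_integrable measurableT _ _ _ (integrableD measurableT iB ic)).
have -> : (fun w => (Y w - c) ^+ 2) = (fun w => (Y w ^+ 2 - 2 * c * Y w) + c ^+ 2).
  by apply/funext => w; ring.
rewrite unlock -EFin_Rintegral//; congr EFin.
rewrite RintegralD// RintegralB// RintegralZl// Rintegral_cst//.
by rewrite [X in fine X]probability_setT mulr1.
Qed.

Lemma variance_Rintegral d (T : measurableType d) (R : realType)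
    (P : probability T R) (Y : T -> R) :
  measurable_fun setT Y -> (forall w, 0 <= Y w <= 1) ->
  'V_P[Y]%E = (\int[P]_w Y w ^+ 2 - (\int[P]_w Y w) ^+ 2)%:E.
Proof.
move=> mY Y01; rewrite /variance unlock.
have EY : fine 'E_P[Y]%E = \int[P]_w Y w by rewrite unlock.
rewrite [X in 'E_P[X]%E](_ : _ = (fun w => (Y w - \int[P]_w Y w) ^+ 2)).
  by rewrite expectation_sqr_dist//; congr EFin; ring.
by apply/funext => w; rewrite !fctE EY.
Qed.

Lemma szasz_estimator_poisson (R : realType) (xs : nat -> R) (m n : nat) (x : R) :
  0 < m%:R * x ->
  szasz_estimator xs m n x =
  \int[poisson (m%:R * x)]_k empirical_cdf xs n (k%:R / m%:R).
Proof.
move=> mx0; rewrite -Rintegral_poisson_series// => k.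
exact: empirical_cdf_unit.
Qed.

Lemma szasz_estimator_moments d (T : measurableType d) (R : realType)
    (P : probability T R) (X : nat -> {RV P >-> R}) (F : R -> R) (m n : nat)
    (x : R) :
  mutually_independent X -> (forall i y, cdf (X i) y = (F y)%:E) ->
  (0 < m)%N -> (0 < n)%N -> 0 < x ->
  let Fhat w := szasz_estimator (fun i => X i w) m n x in
  [/\ measurable_fun setT Fhat, forall w, 0 <= Fhat w <= 1,
      \int[P]_w Fhat w = szasz_mean F m%:R x &
      \int[P]_w Fhat w ^+ 2 = n%:R^-1 * szasz_min_mean F m%:R x
        + (1 - n%:R^-1) * szasz_mean F m%:R x ^+ 2].
Proof.
move=> Xind Xcdf m0 n0 x0 Fhat.
have l0 : 0 < m%:R * x by rewrite mulr_gt0 ?ltr0n.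
have F01 y : 0 <= F y <= 1.
  by rewrite -!lee_fin -(Xcdf 0%N) cdf_ge0 cdf_le1.
set mu := poisson (m%:R * x).
(* The mean of the empirical distribution function on the grid, and below it the mean of its
   products. *)
pose c1 (k : nat) := F (k%:R / m%:R).
pose c2 (k l : nat) := n%:R^-1 * F (Num.min (k%:R / m%:R) (l%:R / m%:R)) +
  (1 - n%:R^-1) * (F (k%:R / m%:R) * F (l%:R / m%:R)).
have [mF Fh01 E1 E2] : [/\ measurable_fun setT Fhat, forall w, 0 <= Fhat w <= 1,
    (\int[P]_w (Fhat w)%:E = \int[mu]_k (c1 k)%:E)%E &
    (\int[P]_w (Fhat w ^+ 2)%:E = \int[mu \x mu]_z (c2 z.1 z.2)%:E)%E].
  have -> : Fhat = (fun w => \int[mu]_k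
      empirical_cdf (fun i => X i w) n (k%:R / m%:R)).
    by apply/funext => w; rewrite /Fhat szasz_estimator_poisson.
  apply: poisson_mixture_moments => //.
  - by move=> k; exact: measurable_empirical_cdf.
  - by move=> w k; exact: empirical_cdf_unit.
  - by move=> k; exact: integral_empirical_cdf.
  - by move=> k l; exact: integral_empirical_cdf_mul.
split=> //.
- by rewrite /Rintegral E1.
rewrite /Rintegral E2 -/(Rintegral _ _ _).
set mu2 : probability _ R := (mu \x mu)%E.
have i1 : mu2.-integrable setT
   (EFin \o (fun z => F (Num.min (z.1%:R / m%:R) (z.2%:R / m%:R)))).
  by apply: integrable_unit_interval => //; exact: measurable_fun_natX.
have i2 : mu2.-integrable setT
   (EFin \o (fun z => F (z.1%:R / m%:R) * F (z.2%:R / m%:R))).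
  apply: integrable_unit_interval => [|z]; first exact: measurable_fun_natX.
  have /andP[a0 a1] := F01 (z.1%:R / m%:R).
  have /andP[b0 b1] := F01 (z.2%:R / m%:R).
  by rewrite mulr_ge0// mulr_ile1.
have iZ (g : nat * nat -> R) (c : R) : mu2.-integrable setT (EFin \o g) ->
    mu2.-integrable setT (EFin \o (fun k => c * g k)).
  by move=> ig; apply: (eq_integrable measurableT _ _ _ (integrableZl measurableT c ig)).
rewrite (RintegralD measurableT (iZ _ _ i1) (iZ _ _ i2)).
rewrite (RintegralZl _ measurableT i1) (RintegralZl _ measurableT i2).
rewrite (Rintegral_prod_mul _ _ _ _ _ mu mu (fun k => F (k%:R / m%:R))
  (fun k => F (k%:R / m%:R)))//.
Qed.

(** * The expansion of the mean-squared error *)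

Theorem theorem6 (d : measure_display) (T : measurableType d) (R : realType)
  (P : probability T R) (X : nat -> {RV P >-> R}) (F f f' : R -> R)
  (X_iid : iid X)
  (X_ge0 : forall i w, 0 <= X i w)
  (X_cdf : forall i y, cdf (X i) y = (F y)%:E)
  (F0 : F 0 = 0)
  (F_cont : continuous F)
  (F_deriv : has_derivative_on `[0, +oo[ F f)
  (f_deriv : has_derivative_on `[0, +oo[ f f')
  (f_cont : {within `[0, +oo[, continuous f})
  (f'_cont : {within `[0, +oo[, continuous f'})
  (f_bnd : [bounded f y | y in `[0, +oo[])
  (f'_bnd : [bounded f' y | y in `[0, +oo[])
  (x : R) (x_gt0 : 0 < x) :
  let Fhat (m n : nat) (w : T) := szasz_estimator (fun i => X i w) m n x in
  let sigma2 := F x * (1 - F x) in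
  let VS := f x * (x / pi) `^ (1 / 2) in
  let bS := x * f' x / 2 in
  (forall m n : nat, (1 <= m)%N -> (1 <= n)%N ->
     mse P (Fhat m n) (F x) =
       ('V_P[Fhat m n] + bias P (Fhat m n) (F x) ^+ 2)%E) /\
  exists r1 r2 : nat * nat -> R,
    [/\ forall m n : nat, (1 <= m)%N -> (1 <= n)%N ->
          mse P (Fhat m n) (F x) =
            (n%:R^-1 * sigma2 - m%:R `^ (- (1 / 2)) * n%:R^-1 * VS
             + m%:R ^- 2 * bS ^+ 2 + r1 (m, n) + r2 (m, n))%:E,
        r1 =o_ (filter_prod \oo \oo) (fun mn => mn.1%:R ^- 2 : R) &
        r2 =o_ (filter_prod \oo \oo)
          (fun mn => mn.1%:R `^ (- (1 / 2)) * mn.2%:R^-1 : R)].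
Proof.
move=> Fhat sigma2 VS bS.
have F01 y : 0 <= F y <= 1.
  by rewrite -!lee_fin -(X_cdf 0%N) cdf_ge0 cdf_le1.
pose S (m : nat) := szasz_mean F m%:R x.
pose A (m : nat) := szasz_min_mean F m%:R x.
have mom m n (m1 : (1 <= m)%N) (n1 : (1 <= n)%N) :=
  szasz_estimator_moments _ _ _ P X F m n x X_iid.1 X_cdf m1 n1 x_gt0.
have mseE m n : (1 <= m)%N -> (1 <= n)%N ->
  mse P (Fhat m n) (F x) = (n%:R^-1 * (A m - S m ^+ 2) + (S m - F x) ^+ 2)%:E.
  move=> m1 n1; have [mF F01' E1 E2] := mom m n m1 n1.
  rewrite /mse expectation_sqr_dist// E1 E2 -/(S m) -/(A m); congr EFin.
  by ring.
split.
  move=> m n m1 n1; rewrite mseE//; have [mF F01' E1 E2] := mom m n m1 n1.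
  rewrite variance_Rintegral// E1 E2 /bias unlock -EFin_Rintegral; last first.
    exact: integrable_unit_interval.
  rewrite E1 -/(S m) -/(A m) -EFinB -EFin_expe -EFinD; congr EFin.
  by ring.
have [[M M0 T1] T2] := Taylor_nonneg R F f f' x F_cont F_deriv f_deriv f_cont
  f'_bnd x_gt0.
have vor := szasz_mean_Voronovskaya R F x (f x) (f' x) x_gt0 T2.
have V0 (m : nat) : m%:R `^ (- (1 / 2)) * VS = f x * Num.sqrt (x / pi) / Num.sqrt m%:R.
  have xpi : 0 <= x / pi by rewrite divr_ge0 ?pi_ge0// ltW.
  by rewrite /VS powRN !div1r !powR12_sqrt// mulrC.
(* [r1] is the error in the squared bias and [r2] the error in the variance. *)
pose r1 (mn : nat * nat) := (S mn.1 - F x) ^+ 2 - mn.1%:R ^- 2 * bS ^+ 2.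
pose r2 (mn : nat * nat) := mn.2%:R^-1 *
  (A mn.1 - S mn.1 ^+ 2 - sigma2 + mn.1%:R `^ (- (1 / 2)) * VS).
(* Both estimates hold for all n once m is large: [r1] is free of n, and the factor 1/n of [r2] also
   appears in its comparison function. *)
have nearN (N : R) (Q : nat * nat -> Prop) :
    (forall m n, N <= m%:R -> Q (m, n)) -> \forall mn \near filter_prod \oo \oo, Q mn.
  move=> NQ; exists ([set m | N <= m%:R], setT) => /=.
    by split; [exact: nbhs_infty_ger|exact: filterT].
  by move=> [m n] [/= Nm _]; exact: NQ.
exists r1, r2; split.
- move=> m n m1 n1; rewrite mseE//; congr EFin.
  by rewrite /r1 /r2/=; ring.
- apply/eqoP => e e0.
  pose b := `|bS|; have b0 : 0 <= b by exact: normr_ge0.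
  (* With |D| <= q/m for the Voronovskaya remainder D, [r1] is at most q (2b + q) / m^2. Taking q <=
     1 bounds the bracket by 2b + 1, and the second entry of the minimum then makes the product at
     most e. *)
  pose q := Num.min 1 (e / (2 * b + 1)).
  have d0 : 0 < 2 * b + 1 by rewrite ltr_wpDl// mulr_ge0.
  have q0 : 0 < q by rewrite lt_min ltr01/= divr_gt0.
  have qe : q * (2 * b + q) <= e.
    have q1 : q <= 1 by rewrite ge_min lexx.
    have : q * (2 * b + 1) <= e by rewrite -ler_pdivlMr// ge_min lexx orbT.
    by apply: le_trans; rewrite ler_wpM2l ?(ltW q0)// lerD2l.
  have [N N0 HN] := vor q q0.
  apply: (nearN N) => m n Nm /=.
  have m0 : 0 < (m%:R : R) by exact: lt_le_trans N0 Nm.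
  have := HN _ Nm; rewrite -/(S m).
  set D := S m - F x - _ => HD.
  have -> : r1 (m, n) = D * (2 * bS / m%:R + D).
    by rewrite /r1 /D /bS /=; field; rewrite gt_eqF.
  rewrite normrM [`|_ ^- 2|]gtr0_norm ?invr_gt0 ?exprn_gt0//.
  have HD2 : `|2 * bS / m%:R + D| <= (2 * b + q) / m%:R.
    rewrite (le_trans (ler_normD _ _))// (mulrDl (2 * b)) lerD//.
    rewrite (normrM (2 * bS)) (normrM 2) [`|_^-1|]gtr0_norm ?invr_gt0//.
    by rewrite ger0_norm.
  apply: (le_trans (ler_pM _ _ HD HD2)) => //.
  have -> : q / m%:R * ((2 * b + q) / m%:R) = q * (2 * b + q) / m%:R ^+ 2.
    by field; rewrite gt_eqF.
  by rewrite ler_wpM2r// invr_ge0 exprn_ge0// ltW.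
- apply/eqoP => e e0.
  (* The first two summands bound the error in A; the last bounds |S^2 - F(x)^2| <= 2 |S - F(x)|,
     since S and F(x) lie in [0, 1]. *)
  pose C := 2 * M * x + `|f x| + 2 * (M * x).
  have r2C (m : nat) : 0 < (m%:R : R) -> `|A m - S m ^+ 2 - sigma2 + m%:R `^ (- (1 / 2)) * VS| <= C / m%:R.
    move=> m0; rewrite V0.
    have hA := szasz_min_mean_dist R F m%:R x (f x) M m0 x_gt0 M0 T1.
    have hS := szasz_mean_dist R F m%:R x (f x) M m0 x_gt0 T1.
    rewrite -/(A m) in hA; rewrite -/(S m) in hS.
    set c := f x * _ / _ in hA *.
    have -> : A m - S m ^+ 2 - sigma2 + c = (A m - F x + c) - (S m - F x) * (S m + F x).
      by rewrite /sigma2; ring.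
    rewrite (le_trans (ler_normB _ _))// /C (mulrDl (2 * M * x + `|f x|)).
    rewrite lerD// normrM mulrC.
    have S01 : 0 <= S m <= 1.
      by apply: Rintegral_unit_interval => // k; exact: F01.
    rewrite -!mulrA ler_pM//.
    by rewrite ger0_norm; have := F01 x; lra.
  have C0 : 0 <= C.
    by rewrite /C !addr_ge0// ?mulr_ge0// ltW.
  (* C / m <= e / sqrt(m) amounts to C / e <= sqrt(m); the summand 1 makes m positive. *)
  apply: (nearN (1 + (C / e) ^+ 2)) => m n Nm /=.
  have m0 : 0 < (m%:R : R).
    by apply: lt_le_trans Nm; rewrite ltr_pwDl// sqr_ge0.
  have n0 : 0 <= (n%:R : R)^-1 by rewrite invr_ge0.
  have sm : 0 < Num.sqrt (m%:R : R) by rewrite sqrtr_gt0.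
  have sE : m%:R `^ (- (1 / 2)) = (Num.sqrt m%:R)^-1 :> R.
    by rewrite powRN div1r powR12_sqrt.
  rewrite /r2 /= !normrM (ger0_norm n0) [leRHS]mulrA [leRHS]mulrC ler_wpM2l//.
  rewrite (le_trans (r2C m m0))// [X in `|X|]sE ger0_norm ?invr_ge0//.
  rewrite ler_pdivrMr// -{2}(sqr_sqrtr (ltW m0)) expr2 mulrA divfK ?gt_eqF//.
  rewrite mulrC -ler_pdivrMr// -[leLHS]ger0_norm ?divr_ge0 ?(ltW e0)//.
  rewrite -sqrtr_sqr ler_sqrt// (le_trans _ Nm)// lerDr.
  exact: ler01.
Qed.
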